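(* For all $f\in\dot H^2(\mathbb{R}^3)$, for all $g\in L^2(\mathbb{R}^3)$, and for all $S\in L^2_{st}$, $$\langle S,gI_3\rangle=0\qquad\text{and}\qquad\langle S,\operatorname{Hess}(f)\rangle=0.$$
   Context: $f$ and $g$ are scalar functions. $I_3$ is the $3\times3$ identity matrix, $\operatorname{Hess}(f)_{ij}=\partial_{x_i}\partial_{x_j}f$, and $\langle P,Q\rangle=\int_{\mathbb{R}^3}\sum_{i,j=1}^3P_{ij}Q_{ij}$ is the $L^2$ inner product of matrix-valued functions. The strain subspace is $$L^2_{st}=\left\{\nabla_{sym}u:\ u\in\dot H^1(\mathbb{R}^3;\mathbb{R}^3),\ \nabla\cdot u=0\right\}\subset L^2(\mathbb{R}^3;S^{3\times3}),$$ where $S^{3\times3}$ denotes real symmetric $3\times3$ matrices and $(\nabla_{sym}u)_{ij}=\frac12\left(\frac{\partial u_j}{\partial x_i}+\frac{\partial u_i}{\partial x_j}\right)$. *)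

(* Defs.v *)
From HB Require Import structures.
From mathcomp Require Export all_boot all_order all_algebra.
From mathcomp Require Export all_classical all_reals all_analysis.
Set Implicit Arguments.
Unset Strict Implicit.
Unset Printing Implicit Defensive.
Export Order.TTheory GRing.Theory Num.Theory.
Export numFieldNormedType.Exports.
#[global] Open Scope classical_set_scope.
#[global] Open Scope ring_scope.

(* Three-dimensional Euclidean space is the product R * R * R, with the product
   normed space structure.  [measurableTypeR R] is R itself, equipped with the
   Borel sigma-algebra under the display that the library's Lebesgue measure
   uses; [mR3 R] is thus convertible to R * R * R. *)
Notation mR3 R :=
  (measurableTypeR R * measurableTypeR R * measurableTypeR R)%type.

(* The library's own sigma-finiteness instance for products is shadowed there
   by the one for subprobabilities, and is not found by inference. *)
Lemma sigma_finite_product_measure d1 d2 (T1 : measurableType d1)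
    (T2 : measurableType d2) (R : realType)
    (m1 : {sigma_finite_measure set T1 -> \bar R})
    (m2 : {sigma_finite_measure set T2 -> \bar R}) :
  sigma_finite setT (m1 \x m2)%E.
Proof.
have /sigma_finiteP[F [TF ndF Foo]] := sigma_finiteT m1.
have /sigma_finiteP[G [TG ndG Goo]] := sigma_finiteT m2.
exists (fun n => F n `*` G n).
  rewrite -setXTT TF TG predeqE => -[x y]; split.
    move=> [/= [n _ Fnx] [k _ Gky]]; exists (maxn n k) => //; split.
    - by move: x Fnx; exact/subsetPset/ndF/leq_maxl.
    - by move: y Gky; exact/subsetPset/ndG/leq_maxr.
  by move=> [n _ []/= ? ?]; split; exists n.
move=> k; have [? ?] := Foo k; have [? ?] := Goo k.
split; first exact: measurableX.
by rewrite product_measure1E// lte_mul_pinfty// ge0_fin_numE.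
Qed.

Definition leb2 (R : realType) :
    set (measurableTypeR R * measurableTypeR R)%type -> \bar R :=
  (@lebesgue_measure R \x @lebesgue_measure R)%E.

HB.instance Definition _ (R : realType) := Measure.on (@leb2 R).
HB.instance Definition _ (R : realType) :=
  Measure_isSigmaFinite.Build _ _ _ (@leb2 R)
    (sigma_finite_product_measure (@lebesgue_measure R) (@lebesgue_measure R)).

Definition leb3 (R : realType) : set (mR3 R) -> \bar R :=
  (@leb2 R \x @lebesgue_measure R)%E.

HB.instance Definition _ (R : realType) := Measure.on (@leb3 R).
HB.instance Definition _ (R : realType) :=
  Measure_isSigmaFinite.Build _ _ _ (@leb3 R)
    (sigma_finite_product_measure (@leb2 R) (@lebesgue_measure R)).

Section WeakDerivatives.
Variable R : realType.
Implicit Types (f g phi : R * R * R -> R) (s : seq 'I_3).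

Definition basis_vec (i : 'I_3) : R * R * R :=
  ((val i == 0%N)%:R, (val i == 1%N)%:R, (val i == 2%N)%:R).

(* [partial [:: i1; ...; ik] phi] is the classical derivative
   d_{i1} ... d_{ik} phi. *)
Definition partial s phi : R * R * R -> R :=
  foldr (fun i h x => 'D_(basis_vec i) h x) phi s.

Definition test_function phi : Prop :=
  (forall s x, differentiable (partial s phi) x) /\
  compact (closure [set x | phi x != 0]).

Definition locally_integrable3 f : Prop :=
  measurable_fun [set: mR3 R] f /\
  forall K : set (R * R * R), compact K ->
    (\int[@leb3 R]_(x in K) `|f x|%:E < +oo)%E.

Definition L2 : set (R * R * R -> R) := [set f | f \in Lfun (@leb3 R) 2%:E].

Definition is_weak_partial s f g : Prop :=
  locally_integrable3 g /\
  forall phi, test_function phi ->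
    (\int[@leb3 R]_x (f x * partial s phi x)%:E =
     ((-1) ^+ size s)%:E * \int[@leb3 R]_x (g x * phi x)%:E)%E.

Definition weakly_differentiable s f : Prop := exists g, is_weak_partial s f g.

(* A representative of the weak derivative, which is unique up to a.e.
   equality; the zero function if there is no weak derivative. *)
Definition weak_partial s f : R * R * R -> R :=
  xget (fun=> 0) [set g | is_weak_partial s f g].

(* The homogeneous Sobolev space of order k, as a space of functions (not
   quotiented by the polynomials of degree < k, on which the seminorm
   vanishes). *)
Definition Hdot (k : nat) : set (R * R * R -> R) :=
  [set f | locally_integrable3 f /\
     forall s, size s = k ->
       weakly_differentiable s f /\ L2 (weak_partial s f)].

Definition Hdot_vec (k : nat) : set (R * R * R -> 'rV[R]_3) :=
  [set u | forall i, Hdot k (fun x => u x 0 i)].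

Definition Hess f (x : R * R * R) : 'M[R]_3 :=
  \matrix_(i, j) weak_partial [:: i; j] f x.

Definition nabla_sym (u : R * R * R -> 'rV[R]_3) (x : R * R * R) : 'M[R]_3 :=
  \matrix_(i, j) (2^-1 * (weak_partial [:: i] (fun y => u y 0 j) x +
                          weak_partial [:: j] (fun y => u y 0 i) x)).

Definition div (u : R * R * R -> 'rV[R]_3) (x : R * R * R) : R :=
  \sum_(i < 3) weak_partial [:: i] (fun y => u y 0 i) x.

Definition L2_sym : set (R * R * R -> 'M[R]_3) :=
  [set S : R * R * R -> 'M[R]_3 |
     (forall i j, L2 (fun x => S x i j)) /\
     (\forall x \ae (@leb3 R), (S x)^T = S x)].

Definition L2_st : set (R * R * R -> 'M[R]_3) :=
  [set S : R * R * R -> 'M[R]_3 | L2_sym S /\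
     exists u, [/\ Hdot_vec 1 u,
                   \forall x \ae (@leb3 R), div u x = 0 &
                   \forall x \ae (@leb3 R), S x = nabla_sym u x]].

(* Extended-real valued, so that a value 0 cannot come from a divergent
   integral: the library has +oo - +oo = -oo in \bar R. *)
Definition inner (P Q : R * R * R -> 'M[R]_3) : \bar R :=
  (\int[@leb3 R]_x (\sum_(i < 3) \sum_(j < 3) P x i j * Q x i j)%:E)%E.

End WeakDerivatives.

(* Main.v *)
From HB Require Import structures.
Require Import Defs.
From mathcomp Require Import measurable_realfun ring lra.

Set Implicit Arguments.
Unset Strict Implicit.
Unset Printing Implicit Defensive.

(** Why the strain space is orthogonal to g I and to Hess f.

    For S = nabla_sym u, the product S : g I is g tr S = g div u, which
    vanishes almost everywhere.

    For the Hessian, write A_ij for the weak derivative d_i u_j and H_ij for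
    d_i d_j f, all of them in L2.  By the symmetry of S it is enough that
    sum_ij int A_ij H_ij = 0, for H and for its transpose.  Consider the
    cross-correlation
      F(y) = sum_ij int A_ij(x + y) H_ij(x) dx.
    Its gradient vanishes in the weak sense.  Indeed d_m A_ij = d_i A_mj, so
    one derivative can be moved as in
      d_m A_ij . H_ij -> A_mj . d_i H_ij = A_mj . d_j H_ii -> d_m A_jj . H_ii,
    each step being the definition of a weak derivative tested against a
    translate or a reflection of one test function, and sum_j A_jj = div u = 0.
    So F is constant.  It tends to 0 at infinity, as every correlation of two
    L2 functions does, and F(0) is the integral to compute.

    F is handled through its averages
      kform k A B = int int A(z) B(x) phi(z - x) dx dz,  k(z, x) = phi(z - x),
    which are finite by Schur's test.  [sum_kform_eq0] is the vanishing of the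
    weak gradient of F: sum_ij of the averages of A_ij, H_ij against d_m phi
    is 0.  Take for phi a tensor product whose first factor is a plateau
    with derivative alpha_n(t) - alpha_n(t - n), where alpha_n is a bump of
    mass 1 supported in (0, 1/(n+1)).  The average against alpha_n (x) alpha_n
    (x) alpha_n tends to int A B, and the one against its translate by n along
    the first axis tends to 0; both limits are [kform_cvg].  That lemma is
    proved on indicator functions and extended to L2, in one argument and then
    in the other, by the density principle [sqint_cvg0].  Because the bumps
    live on positive t only, the convenient indicators are those of sets that
    are locally constant from the left ([left_constant]): for these the
    averages are eventually equal to their limit at every single point. *)

(** * Smooth functions of one variable *)

Section Smooth.
Variable R : realType.
Implicit Types (a b : R -> R).

Lemma derive1_eq a a' :
  (forall x : R, is_derive x 1 a (a' x)) -> derive1 a = a'.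
Proof. by move=> aa'; apply/funext => x; rewrite derive1E derive_val. Qed.

(** Smoothness is stated by recursion on the order, one derivative at a time,
    so that a family of functions closed under differentiation is smooth by
    induction on the order, for all members of the family at once. *)
Fixpoint ndiff n a : Prop :=
  if n is m.+1 then (forall x : R, derivable a x 1) /\ ndiff m (derive1 a)
  else True.

Definition smooth a := forall n, ndiff n a.

Lemma is_derive1_derivable a (x : R) :
  derivable a x 1 -> is_derive x 1 a (derive1 a x).
Proof. by move=> da; rewrite derive1E; exact: derivableP. Qed.

Lemma ndiffS n a : ndiff n.+1 a -> ndiff n a.
Proof. by elim: n a => //= n IH a [da [dda h]]; split=> //; apply: IH. Qed.

Lemma ndiff_derive n a a' : (forall x : R, is_derive x 1 a (a' x)) ->
  ndiff n a' -> ndiff n.+1 a.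
Proof.
move=> aa' ha'; split; first by move=> x; case: (aa' x).
by rewrite (derive1_eq aa').
Qed.

Lemma ndiffD n a b : ndiff n a -> ndiff n b -> ndiff n (fun x => a x + b x).
Proof.
elim: n a b => // n IH a b [da ha] [db hb].
apply: (@ndiff_derive _ _ (fun x => derive1 a x + derive1 b x)); last exact: IH.
by move=> x; apply: is_deriveD; exact: is_derive1_derivable.
Qed.

Lemma ndiff_cst n c : ndiff n (fun=> c).
Proof.
elim: n c => // n IH c.
by apply: (@ndiff_derive _ _ (fun=> 0)); last exact: IH.
Qed.

Lemma ndiffM n a b : ndiff n a -> ndiff n b -> ndiff n (fun x => a x * b x).
Proof.
elim: n a b => // n IH a b ha hb.
apply: (@ndiff_derive _ _ (fun x => a x * derive1 b x + b x * derive1 a x)).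
  move=> x; apply: is_deriveM; apply: is_derive1_derivable.
    by case: ha.
  by case: hb.
apply: ndiffD; apply: IH; [exact: ndiffS|by case: hb|exact: ndiffS|by case: ha].
Qed.

Lemma is_derive_affine (k c x : R) : is_derive x 1 (fun y => k * y + c) k.
Proof.
have -> : (fun y => k * y + c) = (k \*: (id : R -> R)) + cst c by [].
by apply: is_derive_eq; rewrite /= addr0 /GRing.scale/= mulr1.
Qed.

Lemma is_derive_comp_affine a (k c x : R) : derivable a (k * x + c) 1 ->
  is_derive x 1 (fun y => a (k * y + c)) (k * derive1 a (k * x + c)).
Proof.
move=> da; rewrite mulrC.
exact: (@is_derive1_comp _ a (fun y => k * y + c) x _ _
  (is_derive1_derivable da) (is_derive_affine k c x)).
Qed.

Lemma ndiff_comp_affine n a (k c : R) : ndiff n a ->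
  ndiff n (fun y => a (k * y + c)).
Proof.
elim: n a => // n IH a [da ha].
apply: (@ndiff_derive _ _ (fun x => k * derive1 a (k * x + c))).
  by move=> x; exact: is_derive_comp_affine.
by apply: ndiffM; [exact: ndiff_cst|exact: IH].
Qed.

Lemma smoothM a b : smooth a -> smooth b -> smooth (fun x => a x * b x).
Proof. by move=> sa sb n; apply: ndiffM. Qed.

Lemma smoothD a b : smooth a -> smooth b -> smooth (fun x => a x + b x).
Proof. by move=> sa sb n; apply: ndiffD. Qed.

Lemma smooth_cst c : smooth (fun=> c).
Proof. by move=> n; exact: ndiff_cst. Qed.

Lemma smooth_comp_affine a (k c : R) :
  smooth a -> smooth (fun y => a (k * y + c)).
Proof. by move=> sa n; exact: ndiff_comp_affine. Qed.

Lemma smooth_derive1 a : smooth a -> smooth (derive1 a).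
Proof. by move=> sa n; have [] := sa n.+1. Qed.

Lemma smooth_derivable a (x : R) : smooth a -> derivable a x 1.
Proof. by move=> /(_ 1)[]. Qed.

Lemma smooth_continuous a : smooth a -> continuous a.
Proof.
by move=> sa x; apply/differentiable_continuous/derivable1_diffP/smooth_derivable.
Qed.

Lemma smooth_primitive a b : (forall x : R, is_derive x 1 a (b x)) ->
  smooth b -> smooth a.
Proof. by move=> ab sb [|n]; [|exact: ndiff_derive ab (sb n)]. Qed.

(** The flat germ x^-k exp(-1/x).  The extra index k makes the family stable
    under differentiation, see [is_derive_expinv]. *)
Definition expinv k x : R := if 0 < x then x^-1 ^+ k * expR (- x^-1) else 0.

(** With t = 1/x, exp t = (exp (t/m))^m >= (t/m)^m for m = k + 2, which leaves
    two spare powers of x: one gives the derivative 0 at the origin. *)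
Lemma expinv_bound k (x : R) :
  0 < x -> `|expinv k x| <= k.+2%:R ^+ k.+2 * x ^+ 2.
Proof.
move=> x0; rewrite /expinv x0 ger0_norm; last first.
  by rewrite mulr_ge0 ?expR_ge0// exprn_ge0// invr_ge0 ltW.
rewrite expRN ler_pdivrMr ?expR_gt0//.
have h : (x^-1 / k.+2%:R) ^+ k.+2 <= expR x^-1.
  have -> : expR x^-1 = expR (x^-1 / k.+2%:R) ^+ k.+2.
    by rewrite -expRM_natr -mulrA mulVf ?mulr1// pnatr_eq0.
  apply: lerXn2r;
    rewrite ?nnegrE ?divr_ge0 ?invr_ge0 ?ler0n ?expR_ge0 ?(ltW x0)//.
  by rewrite (le_trans _ (expR_ge1Dx _))// lerDr.
have {}h := ler_wpM2l _ h.
have c0 : 0 <= k.+2%:R ^+ k.+2 * x ^+ 2 :> R.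
  by rewrite mulr_ge0 ?exprn_ge0 ?ler0n// ltW.
apply: le_trans (h _ c0).
rewrite exprMn !exprVn !exprSr.
have xn := lt0r_neq0 x0.
rewrite le_eqVlt; apply/orP; left; apply/eqP; field.
by rewrite -natrD !pnatr_eq0 xn !expf_neq0 ?pnatr_eq0.
Qed.

Lemma is_derive_expinv k (x : R) :
  is_derive x 1 (expinv k) (expinv k.+2 x - k%:R * expinv k.+1 x).
Proof.
have [x0|x0|x0] := ltgtP (0:R) x; last rewrite -x0.
- pose g (y : R) : R := y^-1 ^+ k * expR (- y^-1).
  have dg : is_derive x 1 g (expinv k.+2 x - k%:R * expinv k.+1 x).
    have dV : is_derive x 1 (fun y : R => y^-1) (- x ^- 2 *: 1).
      by apply: (@is_deriveV _ id); rewrite // gt_eqF.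
    have dN := is_deriveN dV.
    have dEN := @is_derive1_comp _ expR (fun y => - y^-1) x _ _
      (is_derive_expR _) dN.
    have dX := @is_deriveX _ _ _ k x 1 _ dV.
    rewrite (_ : g = (fun y : R => y^-1) ^+ k *
        (expR \o (fun y => - y^-1))); last first.
      by apply/funext => y; rewrite fctE /= exprfctE.
    apply: is_derive_eq (is_deriveM dX dEN) _.
    rewrite /expinv x0 /GRing.scale/=.
    have xn := lt0r_neq0 x0.
    clear g dEN; case: k {dX} => [|k] /=; rewrite !exprfctE/= ?exprSr ?exprVn; field;
      rewrite ?xn ?expf_neq0//.
  apply: near_eq_is_derive dg.
  near=> y; rewrite /g /expinv ifT//; near: y.
  exact: lt_nbhsr.
- have -> : expinv k.+2 x - k%:R * expinv k.+1 x = 0.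
    by rewrite /expinv ltNge (ltW x0)/= mulr0 subr0.
  apply: (@near_eq_is_derive _ _ _ (cst (0:R))).
  near=> y; rewrite /expinv ifF//; apply/negbTE; rewrite -leNgt ltW//; near: y.
  exact: lt_nbhsl.
- have -> : expinv k.+2 0 - k%:R * expinv k.+1 0 = 0.
    by rewrite /expinv ltxx/= mulr0 subr0.
  have lim0 : (fun h => h^-1 *: ((expinv k \o shift 0) (h *: (1:R)) -
      expinv k 0)) @ (0 : R)^' --> (0 : R).
    apply/cvgr0Pnorm_le => e e0.
    near=> h.
    rewrite /= /GRing.scale/= mulr1 addr0 {2}/expinv ltxx subr0 normrM normfV.
    have h0 : h != 0 by near: h; exact: nbhs_dnbhs_neq.
    have [hp|hn] := ltP 0 h; last first.
      by rewrite /expinv ltNge hn/= normr0 mulr0 ltW.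
    rewrite mulrC ler_pdivrMr ?normr_gt0//.
    apply: le_trans (expinv_bound _ hp) _.
    rewrite (gtr0_norm hp) expr2 mulrA ler_pM2r//.
    rewrite -ler_pdivlMl; last by rewrite exprn_gt0// ltr0n.
    apply: ltW; apply: le_lt_trans (ler_norm _) _.
    near: h; apply: dnbhs0_lt.
    by rewrite mulr_gt0// invr_gt0 exprn_gt0// ltr0n.
  apply: DeriveDef; first by apply/cvg_ex; exists 0.
  exact/cvg_lim.
Unshelve. all: by end_near. Qed.

Lemma smooth_expinv k : smooth (expinv k).
Proof.
move=> n; elim: n k => // n IH k.
apply: ndiff_derive; first exact: is_derive_expinv.
apply: ndiffD; first exact: IH.
have -> : (fun x => - (k%:R * expinv k.+1 x)) = (fun x => (- k%:R) * expinv k.+1 x).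
  by apply/funext => x; rewrite mulNr.
by apply: ndiffM; [exact: ndiff_cst|exact: IH].
Qed.

End Smooth.

(** * Bumps, plateaus and the Lebesgue measure of the line *)

Section Bump.
Variable R : realType.
Implicit Types (a b : R -> R).
Local Notation lambda := (@lebesgue_measure R).

Lemma lebesgue_measure_shift (c : R) (A : set R) : measurable A ->
  pushforward lambda (fun x : R => x - c : measurableTypeR R) A = lambda A.
Proof.
have mc : measurable_fun setT (fun x : R => x - c : measurableTypeR R).
  exact: measurable_funB.
move=> mA; apply/esym/lebesgue_measure_unique => //= _ [[x y]] _ <-.
rewrite /pushforward/=.
have -> : (fun x => x - c) @^-1` `]x, y] = `]x + c, y + c]%classic.
  by apply/seteqP; split => t /=; rewrite !in_itv/= ltrBrDr lerBlDr.
rewrite !lebesgue_measure_itv/= !lte_fin ltrD2r -!EFinB.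
by have -> : y + c - (x + c) = y - x by ring.
Qed.

Lemma integral_shift (f : R -> \bar R) (c : R) : measurable_fun setT f ->
  (forall x, 0 <= f x)%E ->
  (\int[lambda]_x f (x - c)%R = \int[lambda]_x f x)%E.
Proof.
move=> mf f0.
have mc : measurable_fun setT (fun x : R => x - c : measurableTypeR R).
  exact: measurable_funB.
pose phi (x : measurableTypeR R) : measurableTypeR R := x - c.
transitivity (\int[pushforward lambda phi]_x f x)%E.
  by rewrite ge0_integral_pushforward.
by apply: eq_measure_integral => //= A mA _; exact: lebesgue_measure_shift.
Qed.

Lemma integral_oppr (f : R -> \bar R) : measurable_fun setT f ->
  (forall x, 0 <= f x)%E ->
  (\int[lambda]_x f (- x)%R = \int[lambda]_x f x)%E.
Proof.
move=> mf f0.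
transitivity (\int[pushforward lambda (-%R : _ -> measurableTypeR R)]_x f x)%E.
  by rewrite ge0_integral_pushforward.
by apply: eq_measure_integral => //= A mA _; exact: lebesgue_measureN.
Qed.

Lemma integral_reflect (f : R -> \bar R) (c : R) : measurable_fun setT f ->
  (forall x, 0 <= f x)%E ->
  (\int[lambda]_x f (c - x)%R = \int[lambda]_x f x)%E.
Proof.
move=> mf f0; rewrite -(integral_oppr mf f0).
rewrite -(@integral_shift (fun x => f (- x)) c)//; last first.
  by apply: measurableT_comp => //; exact: measurable_funN.
by under [RHS]eq_integral do rewrite opprB.
Qed.

Definition compactly_supported a := exists M : R, forall x, M < `|x| -> a x = 0.

Definition bump_fun a := smooth a /\ compactly_supported a.

Lemma bump_derive1 a : bump_fun a -> bump_fun (derive1 a).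
Proof.
move=> [sa [M aM]]; split; first exact: smooth_derive1.
exists M => x Mx; rewrite derive1E.
rewrite (@near_eq_derive _ _ _ _ (cst 0)) ?derive_cst//.
near=> y; apply: aM; near: y.
have : (fun y : R => `|y|) y @[y --> x] --> `|x| by exact: norm_continuous.
by move/cvgr_gt; apply.
Unshelve. all: by end_near. Qed.

Lemma bump_comp_affine a (k c : R) : `|k| = 1 -> bump_fun a ->
  bump_fun (fun x => a (k * x + c)).
Proof.
move=> k1 [sa [M aM]]; split; first exact: smooth_comp_affine.
exists (M + `|c|) => x Mx; apply: aM.
have := lerB_normD (k * x) c.
by move: Mx; rewrite normrM k1 mul1r; lra.
Qed.

Lemma bump_integrable a : bump_fun a -> lambda.-integrable setT (EFin \o a).
Proof.
move=> [sa [M aM]].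
have -> : EFin \o a = (EFin \o a) \_ `[-M, M].
  apply/funext => x; rewrite patchE; case: ifPn => //.
  rewrite notin_setE/= in_itv/= => /negP; rewrite -ler_norml -ltNge => /aM ax.
  by rewrite /= ax.
apply: (integrable_mkcond _ _).1 => //.
apply: (@continuous_compact_integrable R a); first exact: segment_compact.
by apply: continuous_subspaceT; exact: smooth_continuous.
Qed.

(** Both factors are flat at the ends of ]0, d[, the first at 0, the second
    at d. *)
Definition rawbump (d x : R) : R := expinv 0 x * expinv 0 (d - x).

Lemma expinv_ge0 k (x : R) : 0 <= expinv k x.
Proof.
rewrite /expinv; case: ifPn => // x0.
by rewrite mulr_ge0 ?expR_ge0// exprn_ge0// invr_ge0 ltW.
Qed.

Lemma rawbump_ge0 (d x : R) : 0 <= rawbump d x.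
Proof. by rewrite mulr_ge0 ?expinv_ge0. Qed.

Lemma rawbump_supp (d x : R) : ~~ (0 < x < d) -> rawbump d x = 0.
Proof.
rewrite negb_and /rawbump /expinv subr_gt0 => /orP[/negbTE->|/negbTE->];
  by rewrite ?mul0r ?mulr0.
Qed.

Lemma bump_rawbump (d : R) : bump_fun (rawbump d).
Proof.
split.
  apply: smoothM; first exact: smooth_expinv.
  have := @smooth_comp_affine R _ (-1) d (@smooth_expinv R 0).
  by congr smooth; apply/funext => x; rewrite mulN1r addrC.
exists `|d| => x dx; apply: rawbump_supp; apply/negP => /andP[x0 xd].
by move: dx; rewrite (gtr0_norm x0) gtr0_norm ?(lt_trans x0 xd)//; lra.
Qed.

(** On the middle third of ]0, d[ both factors are at least exp(-3/d), since
    exp(-1/x) increases with x. *)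
Lemma rawbump_mass_gt0 (d : R) : 0 < d -> 0 < \int[lambda]_x rawbump d x.
Proof.
move=> d0.
pose c := expR (- (d / 3)^-1) * expR (- (d / 3)^-1).
have c0 : 0 < c by rewrite mulr_gt0 ?expR_gt0.
have cb x : c * \1_`[d / 3, d / 3 + d / 3] x <= rawbump d x.
  rewrite indicE; have [/set_mem/=|_] := boolP (_ \in _); last first.
    by rewrite mulr0 rawbump_ge0.
  rewrite in_itv/= => /andP[x1 x2]; rewrite mulr1.
  have ee y : d / 3 <= y -> expR (- (d / 3)^-1) <= expinv 0 y.
    move=> dy; have d30 : 0 < d / 3 by rewrite divr_gt0.
    have y0 : 0 < y by rewrite (lt_le_trans _ dy).
    by rewrite /expinv y0 expr0 mul1r ler_expR lerN2 lef_pV2.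
  apply: ler_pM; rewrite ?expR_ge0//; apply: ee => //; lra.
apply: (@lt_le_trans _ _ (\int[lambda]_x (c * \1_`[d / 3, d / 3 + d / 3] x))).
  rewrite RintegralZl//; last first.
    exact: integrable_indic_itv.
  rewrite mulr_gt0// /Rintegral integral_indic// setIT.
  have := @lebesgue_measure_itv R `[d / 3, d / 3 + d / 3].
  rewrite /= lte_fin ltrDl divr_gt0// => ->.
  by rewrite -EFinB/=; lra.
apply: le_Rintegral => //; last exact/bump_integrable/bump_rawbump.
have := bump_integrable (bump_rawbump d); apply: le_integrable => //.
- apply/measurable_EFinP/measurable_funM => //.
- move=> x _ /=; rewrite lee_fin ger0_norm ?mulr_ge0 ?(ltW c0)//.
  by rewrite (le_trans (cb x))// ler_norm.
Qed.

Definition ubump (d x : R) : R := rawbump d x / \int[lambda]_y rawbump d y.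

Lemma bump_ubump (d : R) : bump_fun (ubump d).
Proof.
have [sb [M bM]] := bump_rawbump d.
split; first by apply: smoothM => //; exact: smooth_cst.
by exists M => x /bM; rewrite /ubump => ->; rewrite mul0r.
Qed.

Lemma ubump_ge0 (d x : R) : 0 <= ubump d x.
Proof.
by rewrite divr_ge0 ?rawbump_ge0// Rintegral_ge0// => y _; exact: rawbump_ge0.
Qed.

Lemma ubump_supp (d x : R) : ~~ (0 < x < d) -> ubump d x = 0.
Proof. by move=> /rawbump_supp; rewrite /ubump => ->; rewrite mul0r. Qed.

Lemma ubump_mass (d : R) : 0 < d -> \int[lambda]_x ubump d x = 1.
Proof.
move=> d0; rewrite RintegralZr//; last exact/bump_integrable/bump_rawbump.
by rewrite divff// gt_eqF// rawbump_mass_gt0.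
Qed.

Definition ustep (d x : R) : R := \int[lambda]_(t in `]-oo, x]) ubump d t.

Lemma is_derive_ustep d (x : R) : is_derive x 1 (ustep d) (ubump d x).
Proof.
have xx : x < x + 1 by lra.
have [] := @continuous_FTC1 R (ubump d) -oo%O x _ xx.
- by apply: integrableS (bump_integrable (bump_ubump d)).
- exact: ltNyr.
- by have [sb _] := bump_ubump d; exact: smooth_continuous.
by move=> df e; apply: DeriveDef; [exact: df|rewrite -derive1E; exact: e].
Qed.

Lemma ustep_le0 (d x : R) : x <= 0 -> ustep d x = 0.
Proof.
move=> x0; rewrite /ustep (@eq_Rintegral _ _ _ _ _ (cst 0)); last first.
  move=> y; rewrite inE/= in_itv/= => yx; apply: ubump_supp.
  by rewrite negb_and -leNgt (le_trans yx).
by rewrite Rintegral_cst// mul0r.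
Qed.

Lemma ustep_ge (d x : R) : 0 < d -> d <= x -> ustep d x = 1.
Proof.
move=> d0 dx; rewrite /ustep -(ubump_mass d0) Rintegral_mkcond.
apply: eq_Rintegral => y _; rewrite patchE; case: ifPn => //.
rewrite notin_setE/= in_itv/= => /negP; rewrite -ltNge => xy.
by rewrite ubump_supp// negb_and orbC -leNgt (le_trans dx)// ltW.
Qed.

(** A bump that rises on ]0, d[ and falls on ]c, c + d[ (for 0 < d and c >= d).
    Its derivative is the difference of a unit bump and of its translate by c,
    which is how a weak derivative compares two averages far apart. *)
Definition plateau (d c x : R) : R := ustep d x - ustep d (x - c).

Lemma is_derive_plateau d c (x : R) :
  is_derive x 1 (plateau d c) (ubump d x - ubump d (x - c)).
Proof.
apply: is_deriveB; first exact: is_derive_ustep.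
have := @is_derive1_comp _ (ustep d) (fun y => y - c) x _ 1 (is_derive_ustep d _).
rewrite mulr1; apply.
apply: is_derive_eq (is_deriveB (is_derive_id x (1:R))
  (is_derive_cst c x (1:R))) _.
by rewrite subr0.
Qed.

Lemma derive1_plateau (d c : R) :
  derive1 (plateau d c) = fun x => ubump d x - ubump d (x - c).
Proof. by apply: derive1_eq => x; exact: is_derive_plateau. Qed.

Lemma bump_plateau (d c : R) : 0 < d -> bump_fun (plateau d c).
Proof.
move=> d0; split.
  apply: smooth_primitive (is_derive_plateau d c) _.
  have [sb _] := bump_ubump d.
  apply: smoothD => //.
  have -> : (fun x => - ubump d (x - c)) = (fun x => (-1) * ubump d (1 * x + (- c))).
    by apply/funext => x; rewrite mulN1r mul1r.
  by apply: smoothM; [exact: smooth_cst|exact: smooth_comp_affine].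
exists (d + `|c|) => x; rewrite /plateau.
have cN := ler_norm (- c); rewrite normrN in cN; have cP := ler_norm c.
have [x0|x0] := leP 0 x.
  by rewrite (ger0_norm x0) => h; rewrite !ustep_ge ?subrr//; lra.
rewrite (ltr0_norm x0) => h; rewrite !ustep_le0 ?subrr//; lra.
Qed.

End Bump.

(** * Square integrable functions and Schur's test *)

Section SquareIntegrable.
Context d (T : measurableType d) (R : realType).
Variable mu : {measure set T -> \bar R}.
Implicit Types f g : T -> R.

Definition sqint f := measurable_fun setT f /\
  mu.-integrable setT (EFin \o (fun x => f x ^+ 2)).

Definition sqnorm f : R := \int[mu]_x f x ^+ 2.

Lemma Lfun2_sqint f : f \in Lfun mu 2%:E -> sqint f.
Proof.
move=> Lf; split; last exact: Lfun2_integrable_sqr.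
by move: Lf; rewrite inE => /andP[+ _]; rewrite inE.
Qed.

Lemma sqnorm_ge0 f : 0 <= sqnorm f.
Proof. by apply: Rintegral_ge0 => x _; exact: sqr_ge0. Qed.

Lemma integral_sqr f : sqint f -> (\int[mu]_x (f x ^+ 2)%:E = (sqnorm f)%:E)%E.
Proof.
move=> [mf If]; rewrite /sqnorm /Rintegral fineK//.
exact: integrable_fin_num.
Qed.

Lemma sqint_le f g : measurable_fun setT f -> (forall x, `|f x| <= `|g x|) ->
  sqint g -> sqint f.
Proof.
move=> mf fg [mg Ig]; split=> //; apply: le_integrable Ig => //.
  by apply/measurable_EFinP; exact: measurable_funX.
by move=> x _ /=; rewrite lee_fin !normrX lerXn2r ?nnegrE.
Qed.

Lemma sqintZ c f : sqint f -> sqint (fun x => c * f x).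
Proof.
move=> [mf If]; split; first exact: measurable_funM.
have := integrableZl measurableT (c ^+ 2) If.
by apply: eq_integrable => // x _ /=; rewrite exprMn EFinM.
Qed.

Lemma sqintD f g : sqint f -> sqint g -> sqint (fun x => f x + g x).
Proof.
move=> [mf If] [mg Ig]; split; first exact: measurable_funD.
have I2 := integrableD measurableT (integrableZl measurableT 2 If)
  (integrableZl measurableT 2 Ig).
apply: le_integrable I2 => //.
  by apply/measurable_EFinP; apply: measurable_funX; exact: measurable_funD.
move=> x _ /=; rewrite lee_fin !ger0_norm ?sqr_ge0//.
  by have := sqr_ge0 (f x - g x); nra.
by rewrite addr_ge0// mulr_ge0// sqr_ge0.
Qed.

Lemma sqintB f g : sqint f -> sqint g -> sqint (fun x => f x - g x).
Proof.
move=> sf sg; have := sqintD sf (sqintZ (-1) sg).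
by congr sqint; apply/funext => x; rewrite mulN1r.
Qed.

Lemma sqint0 : sqint (fun=> 0).
Proof.
split; first exact: measurable_cst.
have := @integrable0 _ T R mu setT; apply: eq_integrable => // x _ /=.
by rewrite expr0n.
Qed.

(** Young's inequality with a free parameter replaces the Cauchy-Schwarz
    inequality throughout: it adds up under integrals without any square root,
    and the choice of t is postponed to the one place where a limit is taken. *)
Lemma young (a b t : R) : 0 < t -> `|a * b| <= t * a ^+ 2 + t^-1 * b ^+ 2.
Proof.
move=> t0; have ti0 : 0 < t^-1 by rewrite invr_gt0.
have tt : t * t^-1 = 1 by rewrite divff// gt_eqF.
have h1 : 0 <= t * (a - t^-1 * b) ^+ 2 by rewrite mulr_ge0 ?sqr_ge0 ?ltW.
have h2 : 0 <= t * (a + t^-1 * b) ^+ 2 by rewrite mulr_ge0 ?sqr_ge0 ?ltW.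
have e1 : t * (a - t^-1 * b) ^+ 2 = t * a ^+ 2 + t^-1 * b ^+ 2 - 2 * (a * b).
  by field; rewrite gt_eqF.
have e2 : t * (a + t^-1 * b) ^+ 2 = t * a ^+ 2 + t^-1 * b ^+ 2 + 2 * (a * b).
  by field; rewrite gt_eqF.
have h3 : 0 <= t * a ^+ 2 by rewrite mulr_ge0 ?sqr_ge0 ?ltW.
have h4 : 0 <= t^-1 * b ^+ 2 by rewrite mulr_ge0 ?sqr_ge0 ?ltW.
rewrite e1 in h1; rewrite e2 in h2.
rewrite ler_norml; apply/andP; split; lra.
Qed.

Lemma integrableM_sqint f g : sqint f -> sqint g ->
  mu.-integrable setT (EFin \o (fun x => f x * g x)).
Proof.
move=> [mf If] [mg Ig].
apply: le_integrable (integrableD measurableT If Ig) => //.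
  by apply/measurable_EFinP; exact: measurable_funM.
move=> x _ /=; rewrite lee_fin [leRHS]ger0_norm ?addr_ge0 ?sqr_ge0//.
by have := young (f x) (g x) ltr01; rewrite invr1 !mul1r.
Qed.

Lemma Rintegral_mul_le f g (t : R) : 0 < t -> sqint f -> sqint g ->
  `|\int[mu]_x (f x * g x)| <= t * sqnorm f + t^-1 * sqnorm g.
Proof.
move=> t0 sf sg; have [mf If] := sf; have [mg Ig] := sg.
apply: le_trans (le_normr_Rintegral _ (integrableM_sqint sf sg)) _ => //.
rewrite /sqnorm -!RintegralZl// -RintegralD//; last first.
- by have := integrableZl measurableT t^-1 Ig.
- by have := integrableZl measurableT t If.
apply: le_Rintegral => //.
- by have := integrable_norm (integrableM_sqint sf sg).
- by have := integrableD measurableT (integrableZl measurableT t If)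
    (integrableZl measurableT t^-1 Ig).
- by move=> x _; exact: young.
Qed.

End SquareIntegrable.

Section Schur.
Context d (T : measurableType d) (R : realType).
Variable mu : {sigma_finite_measure set T -> \bar R}.
Implicit Types A B : T -> R.
Local Notation sqint := (@sqint _ _ _ mu).
Local Notation sqnorm := (@sqnorm _ _ _ mu).

(** A uniform bound C on both marginals of |k| makes the form [kform k] below
    bounded on L2 x L2, by [schur_test]. *)
Definition schur_kernel (C : R) (k : T * T -> R) := [/\ measurable_fun setT k,
  (forall z, \int[mu]_x `|k (z, x)|%:E <= C%:E)%E &
  (forall x, \int[mu]_z `|k (z, x)|%:E <= C%:E)%E].

Definition kform (k : T * T -> R) A B : R :=
  \int[(mu \x mu)%E]_p (A p.1 * B p.2 * k p).

Lemma measurable_kform k A B : measurable_fun setT k ->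
  measurable_fun setT A -> measurable_fun setT B ->
  measurable_fun setT (fun p : T * T => A p.1 * B p.2 * k p).
Proof.
move=> mk mA mB; apply: measurable_funM => //; apply: measurable_funM.
  exact: measurableT_comp.
exact: measurableT_comp.
Qed.

(** Young's inequality splits |A(z) B(x) k(z, x)| into A(z)^2 |k| and
    B(x)^2 |k|; integrating the free variable first, each costs a factor C. *)
Lemma schur_test (C t : R) k A B : schur_kernel C k -> 0 < t ->
  sqint A -> sqint B ->
  (\int[(mu \x mu)]_p `|A p.1 * B p.2 * k p|%:E <=
    (C * (t * sqnorm A + t^-1 * sqnorm B))%:E)%E.
Proof.
move=> [mk kz kx] t0 sA sB; have [mA IA] := sA; have [mB IB] := sB.
have mk' : measurable_fun setT (fun p => `|k p|) by exact: measurableT_comp.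
have mA2 : measurable_fun setT (fun z => A z ^+ 2) by exact: measurable_funX.
have mB2 : measurable_fun setT (fun z => B z ^+ 2) by exact: measurable_funX.
have mAk : measurable_fun setT (fun p : T * T => (A p.1 ^+ 2 * `|k p|)%:E).
  by apply/measurable_EFinP/measurable_funM => //; exact: measurableT_comp mA2 _.
have mBk : measurable_fun setT (fun p : T * T => (B p.2 ^+ 2 * `|k p|)%:E).
  by apply/measurable_EFinP/measurable_funM => //; exact: measurableT_comp mB2 _.
have C0 z : (0 <= \int[mu]_x `|k (z, x)|%:E)%E.
  by apply: integral_ge0 => x _; rewrite lee_fin.
have boundA : (\int[(mu \x mu)]_p (A p.1 ^+ 2 * `|k p|)%:E <= (C * sqnorm A)%:E)%E.
  rewrite fubini_tonelli1//=; last by move=> p; rewrite lee_fin mulr_ge0 ?sqr_ge0.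
  apply: (@le_trans _ _ (\int[mu]_z (C%:E * (A z ^+ 2)%:E))%E); last first.
    rewrite integralZl// integral_sqr//.
  apply: ge0_le_integral => //.
  - by move=> z _; apply: integral_ge0 => x _ /=; rewrite lee_fin mulr_ge0 ?sqr_ge0.
  - apply: (measurable_fun_fubini_tonelli_F
      (fun p : T * T => (A p.1 ^+ 2 * `|k p|)%:E)) => //.
    by move=> p; rewrite lee_fin mulr_ge0 ?sqr_ge0.
  - by apply/measurable_EFinP/measurable_funM.
  - move=> z _ /=; rewrite /fubini_F/=; under eq_integral do rewrite EFinM.
    rewrite ge0_integralZl//.
    + by rewrite muleC lee_wpmul2r// lee_fin sqr_ge0.
    + by apply/measurable_EFinP; exact: measurableT_comp mk' _.
    + by rewrite lee_fin sqr_ge0.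
have boundB : (\int[(mu \x mu)]_p (B p.2 ^+ 2 * `|k p|)%:E <= (C * sqnorm B)%:E)%E.
  rewrite fubini_tonelli2//=; last by move=> p; rewrite lee_fin mulr_ge0 ?sqr_ge0.
  apply: (@le_trans _ _ (\int[mu]_x (C%:E * (B x ^+ 2)%:E))%E); last first.
    rewrite integralZl// integral_sqr//.
  apply: ge0_le_integral => //.
  - by move=> z _; apply: integral_ge0 => x _ /=; rewrite lee_fin mulr_ge0 ?sqr_ge0.
  - apply: (measurable_fun_fubini_tonelli_G
      (fun p : T * T => (B p.2 ^+ 2 * `|k p|)%:E)) => //.
    by move=> p; rewrite lee_fin mulr_ge0 ?sqr_ge0.
  - by apply/measurable_EFinP/measurable_funM.
  - move=> x _ /=; rewrite /fubini_G/=; under eq_integral do rewrite EFinM.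
    rewrite ge0_integralZl//.
    + by rewrite muleC lee_wpmul2r// lee_fin sqr_ge0.
    + by apply/measurable_EFinP; exact: measurableT_comp mk' _.
    + by rewrite lee_fin sqr_ge0.
apply: (@le_trans _ _ (\int[(mu \x mu)]_p (t%:E * (A p.1 ^+ 2 * `|k p|)%:E +
    t^-1%:E * (B p.2 ^+ 2 * `|k p|)%:E))%E).
  apply: ge0_le_integral => //.
  - by apply/measurable_EFinP; apply: measurableT_comp => //; exact: measurable_kform.
  - by apply: emeasurable_funD; exact: measurable_funeM.
  - move=> p _; rewrite -!EFinM -EFinD lee_fin normrM (mulrA t) (mulrA t^-1) -mulrDl.
    by rewrite ler_wpM2r// young.
rewrite ge0_integralD//; last 4 first.
- by move=> p _; rewrite -EFinM lee_fin mulr_ge0 ?(ltW t0)// mulr_ge0 ?sqr_ge0.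
- exact: measurable_funeM.
- by move=> p _; rewrite -EFinM lee_fin mulr_ge0 ?invr_ge0 ?(ltW t0)// mulr_ge0 ?sqr_ge0.
- exact: measurable_funeM.
have ti0 : 0 <= t^-1 by rewrite invr_ge0 ltW.
rewrite !ge0_integralZl//;
  try (by move=> p _; rewrite lee_fin mulr_ge0 ?sqr_ge0);
  try (by rewrite lee_fin ltW).
rewrite mulrDr EFinD !(mulrCA C) !EFinM; apply: leeD.
  by rewrite lee_wpmul2l ?lee_fin ?(ltW t0)// -EFinM.
by rewrite lee_wpmul2l ?lee_fin// -EFinM.
Qed.

Lemma kform_integrable C k A B : schur_kernel C k -> sqint A -> sqint B ->
  (mu \x mu)%E.-integrable setT (EFin \o (fun p => A p.1 * B p.2 * k p)).
Proof.
move=> hk sA sB; apply/integrableP; split.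
  apply/measurable_EFinP; case: hk sA sB => mk _ _ [mA _] [mB _].
  exact: measurable_kform.
by apply: le_lt_trans (schur_test hk ltr01 sA sB) (ltry _).
Qed.

Lemma kform_le C t k A B : schur_kernel C k -> 0 < t -> sqint A -> sqint B ->
  `|kform k A B| <= C * (t * sqnorm A + t^-1 * sqnorm B).
Proof.
move=> hk t0 sA sB; have I := kform_integrable hk sA sB.
rewrite -lee_fin /kform EFin_normr_Rintegral//.
apply: le_trans (schur_test hk t0 sA sB).
exact: le_abse_integral (measurable_int _ I).
Qed.

Lemma kform_fubini1 C k A B : schur_kernel C k -> sqint A -> sqint B ->
  (forall z, sqint (fun x => k (z, x))) ->
  kform k A B = \int[mu]_z (A z * \int[mu]_x (B x * k (z, x))).
Proof.
move=> hk sA sB sk; have I := kform_integrable hk sA sB.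
rewrite /kform /Rintegral -integral12_prod_meas1//; congr fine.
apply: eq_integral => z _; rewrite /fubini_F/=.
have Iz := integrableM_sqint sB (sk z).
under eq_integral do rewrite -mulrA EFinM.
rewrite integralZl//.
by rewrite EFinM fineK//; exact: integrable_fin_num.
Qed.

Lemma kform_fubini2 C k A B : schur_kernel C k -> sqint A -> sqint B ->
  (forall x, sqint (fun z => k (z, x))) ->
  kform k A B = \int[mu]_x (B x * \int[mu]_z (A z * k (z, x))).
Proof.
move=> hk sA sB sk; have I := kform_integrable hk sA sB.
rewrite /kform /Rintegral -integral21_prod_meas1//; congr fine.
apply: eq_integral => x _; rewrite /fubini_G/=.
have Ix := integrableM_sqint sA (sk x).
under eq_integral do rewrite (mulrC (A _)) -mulrA EFinM.
rewrite integralZl//.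
by rewrite EFinM fineK//; exact: integrable_fin_num.
Qed.

Lemma kformDl C k c A A' B : schur_kernel C k -> sqint A -> sqint A' -> sqint B ->
  kform k (fun z => c * A z + A' z) B = c * kform k A B + kform k A' B.
Proof.
move=> hk sA sA' sB; have I := kform_integrable hk sA sB.
have I' := kform_integrable hk sA' sB.
rewrite /kform -RintegralZl// -RintegralD//; last exact: (integrableZl _ c I).
by apply: eq_Rintegral => p _; ring.
Qed.

Lemma kformDr C k c A B B' : schur_kernel C k -> sqint A -> sqint B -> sqint B' ->
  kform k A (fun x => c * B x + B' x) = c * kform k A B + kform k A B'.
Proof.
move=> hk sA sB sB'; have I := kform_integrable hk sA sB.
have I' := kform_integrable hk sA sB'.
rewrite /kform -RintegralZl// -RintegralD//; last exact: (integrableZl _ c I).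
by apply: eq_Rintegral => p _; ring.
Qed.

End Schur.

(** * A density principle for sequences of functionals on L2 *)

Section Density.
Context d (T : measurableType d) (R : realType).
Variable mu : {measure set T -> \bar R}.
Local Notation sqint := (@sqint _ _ _ mu).
Local Notation sqnorm := (@sqnorm _ _ _ mu).

Lemma dominated_cvg_Rintegral (f_ : nat -> T -> R) (f g : T -> R) :
  (forall n, measurable_fun setT (f_ n)) ->
  (forall x, f_ ^~ x @ \oo --> f x) ->
  mu.-integrable setT (EFin \o g) -> (forall n x, `|f_ n x| <= g x) ->
  \int[mu]_x f_ n x @[n --> \oo] --> \int[mu]_x f x.
Proof.
move=> mf_ ff ig fg.
have mf : measurable_fun setT f by apply: measurable_fun_cvg mf_ _ => x _; exact: ff.
have ffE x : (EFin (f_ n x)) @[n --> \oo] --> (f x)%:E.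
  by apply: cvg_EFin; [exact: nearW|exact: ff].
have [If _] := @dominated_convergence _ _ _ mu _ measurableT
  (fun n => EFin \o f_ n) (EFin \o f) (EFin \o g)
  (fun n => (measurable_EFinP _ _).2 (mf_ n)) ((measurable_EFinP _ _).2 mf)
  (aeW _ (fun x _ => ffE x)) ig
  (aeW _ (fun x n _ => fg n x)).
move=> h; apply: fine_cvg; rewrite fineK//.
exact: integrable_fin_num If.
Qed.

Lemma sqnorm_cvg0 (f_ : nat -> T -> R) (f g : T -> R) :
  (forall n, measurable_fun setT (f_ n)) ->
  (forall x, f_ ^~ x @ \oo --> f x) ->
  sqint g -> (forall n x, `|f_ n x| <= g x) ->
  sqnorm (fun x => f_ n x - f x) @[n --> \oo] --> 0.
Proof.
move=> mf_ ff [mg ig] fg.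
have mf : measurable_fun setT f by apply: measurable_fun_cvg mf_ _ => x _; exact: ff.
have fg' x : `|f x| <= g x.
  apply: cvgr_to_le (cvg_norm (ff x)) _; last by apply: nearW => n; exact: fg.
have <- : \int[mu]_x (0 : R) = 0 by rewrite Rintegral_cst// mul0r.
apply: (@dominated_cvg_Rintegral _ _ (fun x => 4 * g x ^+ 2)).
- by move=> n; apply: measurable_funX; exact: measurable_funB.
- move=> x.
  have -> : (0 : R) = (f x - f x) ^+ 2 by rewrite subrr expr0n.
  have h : f_ n x - f x @[n --> \oo] --> f x - f x.
    by apply: cvgB; [exact: ff|exact: cvg_cst].
  by rewrite expr2; under eq_cvg do rewrite expr2; exact: cvgM.
- by have := integrableZl measurableT 4 ig.
- move=> n x; rewrite normrX.
  have h : `|f_ n x - f x| <= 2 * g x.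
    by apply: le_trans (ler_normB _ _) _; rewrite mulr2n mulrDl mul1r lerD.
  have -> : 4 * g x ^+ 2 = (2 * g x) ^+ 2 by ring.
  by rewrite lerXn2r ?nnegrE// (le_trans _ h).
Qed.

(** An induction principle for square integrable functions: a property that is
    stable under linear combinations and dominated pointwise limits holds as
    soon as it holds for the indicators of the bounded members of a generating
    pi-system.  The pi-lambda theorem gives the bounded measurable sets, simple
    functions cut off by the exhaustion D give the nonnegative functions, and
    positive and negative parts give the rest. *)
Section Induction.
Import HBSimple HBNNSimple.
Variables (G : set (set T)) (D : nat -> set T).
Hypothesis GI : setI_closed G.
Hypothesis mG : G `<=` measurable.
Hypothesis genG : measurable `<=` <<s G>>.
Hypothesis GD : forall n, G (D n).
Hypothesis ndD : nondecreasing_seq D.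
Hypothesis UD : \bigcup_n D n = setT.
Hypothesis Doo : forall n, (mu (D n) < +oo)%E.

Variable P : (T -> R) -> Prop.
Hypothesis P_indic : forall E n, G E -> E `<=` D n -> P \1_E.
Hypothesis P_lin : forall c f g, P f -> P g -> P (fun x => c * f x + g x).
Hypothesis P_dom : forall (f_ : nat -> T -> R) (f g : T -> R),
  (forall n, P (f_ n)) -> sqint g -> (forall n x, `|f_ n x| <= g x) ->
  (forall x, f_ ^~ x @ \oo --> f x) -> P f.

Let mD n : measurable (D n). Proof. exact/mG/GD. Qed.

Lemma sqint_indic E : measurable E -> (mu E < +oo)%E -> sqint \1_E.
Proof.
move=> mE Eoo; split; first exact: measurable_indic.
apply/integrableP; split.
  by apply/measurable_EFinP/measurable_funX; exact: measurable_indic.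
rewrite (eq_integral (fun x => (\1_E x)%:E)).
  by rewrite integral_indic// setIT.
move=> x _ /=; rewrite ger0_norm ?sqr_ge0// indicE.
by case: (_ \in _); rewrite ?expr1n ?expr0n.
Qed.

Let P_setI_indic E n : measurable E -> P \1_(E `&` D n).
Proof.
suff : <<s G>> `<=` [set E | forall n, P \1_(E `&` D n)].
  by move=> h /genG /h.
apply: (lambda_system_subset GI) => //.
- split => //.
  + by move=> m; rewrite setTI; apply: (P_indic (n := m)).
  + move=> A B BA PA PB m.
    have -> : \1_((A `\` B) `&` D m) =
        (fun x => -1 * \1_(B `&` D m) x + \1_(A `&` D m) x) :> (T -> R).
      apply/funext => x; rewrite !indicE (in_setI x (A `\` B)) in_setD !in_setI.
      have BAx : x \in B -> x \in A by move=> /set_mem /BA /mem_set.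
      case: (boolP (x \in B)) BAx => [_ ->//|_ _] /=; rewrite ?andbF ?andbT/=.
        by case: (x \in D m) => /=; ring.
      by rewrite mulr0 add0r.
    by apply: P_lin.
  + move=> F ndF PF m; apply: (@P_dom (fun n => \1_(F n `&` D m)) _ \1_(D m)).
    * by move=> k; exact: PF.
    * exact: sqint_indic.
    * move=> k x; rewrite !indicE in_setI.
      by case: (_ \in F k); case: (_ \in D m); rewrite /= ?normr1 ?normr0.
    * move=> x; apply: (@cvg_near_cst _ _ _ _ _ eventually_filter).
      rewrite /=; have [[k _ Fkx]|nF] := pselect ((\bigcup_i F i) x).
        exists k => // l /= kl; rewrite !indicE !in_setI.
        have Flx : F l x by move: Fkx; apply/subsetPset; exact: ndF.
        by rewrite (mem_set Flx) (_ : x \in \bigcup_i F i)// inE; exists k.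
      exists 0 => // l _ /=; rewrite !indicE !in_setI (memNset nF).
      by rewrite memNset// => Flx; apply: nF; exists l.
- by move=> E1 GE m; apply: (P_indic (n := m)); [exact: GI|exact: subIsetr].
Qed.

Let P_nonneg f : sqint f -> (forall x, 0 <= f x) -> P f.
Proof.
move=> sf f0; have [mf _] := sf.
have mfE : measurable_fun setT (EFin \o f) by exact/measurable_EFinP.
pose g := nnsfun_approx measurableT mfE.
have gf x : g n x @[n --> \oo] --> f x.
  have := @cvg_nnsfun_approx _ _ _ _ measurableT _ mfE (fun x _ => f0 x) x I.
  by move/fine_cvg.
apply: (@P_dom (fun n x => g n x * \1_(D n) x) f f) => //.
- move=> n.
  have -> : (fun x => g n x * \1_(D n) x) = (fun x =>
      \sum_(r <- finmap.enum_fset (fset_set (range (g n))))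
        (r * \1_((g n @^-1` [set r]) `&` D n) x)).
    apply/funext => x; rewrite fimfunE fsbig_finite//= mulr_suml.
    by apply: eq_bigr => r _; rewrite indicI -mulrA.
  elim: (finmap.enum_fset _) => [|r s IH].
    have := P_lin (-1) (P_setI_indic n measurable0) (P_setI_indic n measurable0).
    by congr P; apply/funext => x; rewrite big_nil mulN1r addNr.
  have mr : measurable (g n @^-1` [set r]).
    by rewrite -[_ @^-1` _]setTI; apply: measurable_funP => //.
  have := P_lin r (P_setI_indic n mr) IH.
  by congr P; apply/funext => x; rewrite big_cons.
- move=> n x; rewrite ger0_norm ?mulr_ge0//.
  apply: (@le_trans _ _ (g n x)).
    by rewrite ler_piMr// indicE; case: (_ \in _).
  rewrite -(cvg_lim _ (gf x))//; apply: nondecreasing_cvgn_le.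
    by move=> i j ij; exact/lefP/nd_nnsfun_approx.
  by apply/cvg_ex; exists (f x).
- move=> x.
  rewrite -[f x]mulr1; apply: cvgM => //.
  apply: (@cvg_near_cst _ _ _ _ _ eventually_filter).
  have : (\bigcup_n D n) x by rewrite UD.
  move=> [k _ Dkx]; exists k => // l /= kl; rewrite indicE mem_set//.
  by move: Dkx; apply/subsetPset; exact: ndD.
Qed.

Lemma sqint_ind f : sqint f -> P f.
Proof.
move=> sf; have [mf _] := sf.
have sp : sqint (fun x => Num.max (f x) 0).
  apply: sqint_le (sf); first exact: measurable_maxr.
  by move=> x; have [fx|fx] := leP (f x) 0; rewrite ?normr0.
have sn : sqint (fun x => Num.max (- f x) 0).
  apply: sqint_le (sf); first by apply: measurable_maxr => //; exact: measurable_funN.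
  by move=> x; have [fx|fx] := leP (- f x) 0; rewrite ?normr0 ?normrN.
have pn : P (fun x => Num.max (- f x) 0).
  by apply: P_nonneg => // x; rewrite le_max lexx orbT.
have pp : P (fun x => Num.max (f x) 0).
  by apply: P_nonneg => // x; rewrite le_max lexx orbT.
have := P_lin (-1) pn pp.
congr P; apply/funext => x; rewrite mulN1r.
by have [fx|fx] := leP (f x) 0; have [gx|gx] := leP (- f x) 0; lra.
Qed.

End Induction.

(** Functionals that are linear and bounded on L2 uniformly in n converge to 0
    everywhere if they do so on a generating class of indicators.  The bound
    has the form produced by Young's inequality: the term t * c is made small
    by the choice of t, and then the other one by approximating f. *)
Lemma sqint_cvg0 (G : set (set T)) (D : nat -> set T)
    (L : nat -> (T -> R) -> R) (c : R) :
  setI_closed G -> G `<=` measurable -> measurable `<=` <<s G>> ->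
  (forall n, G (D n)) -> nondecreasing_seq D -> \bigcup_n D n = setT ->
  (forall n, mu (D n) < +oo)%E ->
  (forall n a f g, sqint f -> sqint g ->
    L n (fun x => a * f x + g x) = a * L n f + L n g) ->
  (forall n (t : R) f, 0 < t -> sqint f -> `|L n f| <= t * c + t^-1 * (c * sqnorm f)) ->
  (forall E n, G E -> E `<=` D n -> L m \1_E @[m --> \oo] --> 0) ->
  forall f, sqint f -> L m f @[m --> \oo] --> 0.
Proof.
move=> GI mG genG GD ndD UD Doo Llin Lbd Lind.
pose P f := sqint f /\ (L m f @[m --> \oo] --> 0).
suff H f : sqint f -> P f by move=> f /H[].
have c0 : 0 <= c.
  have := Lbd 0 1 _ ltr01 (@sqint0 _ _ _ mu).
  have -> : sqnorm (fun=> 0) = 0.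
    rewrite /sqnorm (_ : (fun x => 0 ^+ 2) = fun=> 0); last first.
      by apply/funext=> x; rewrite expr0n.
    by rewrite Rintegral_cst// mul0r.
  by rewrite mulr0 mulr0 addr0 mul1r; exact: le_trans.
apply: (@sqint_ind G D GI mG genG GD ndD UD Doo P) => //.
- move=> E n GE ED; split; last exact: Lind GE ED.
  apply: sqint_indic; first exact: mG.
  apply: le_lt_trans (Doo n); apply: le_measure => //; rewrite inE; exact: mG.
- move=> a g h [sg Lg] [sh Lh]; split; first by apply: sqintD => //; exact: sqintZ.
  under eq_cvg do rewrite Llin//.
  have := cvgD (cvgM (@cvg_cst _ a _ \oo _) Lg) Lh; rewrite mulr0 addr0; exact.
- move=> f_ f1 g Pf sg fg ff.
  have mf_ n : measurable_fun setT (f_ n) by have [[]] := Pf n.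
  have sf1 : sqint f1.
    apply: sqint_le (sg); first by apply: measurable_fun_cvg mf_ _ => x _; exact: ff.
    move=> x; rewrite [leRHS]ger0_norm; last by rewrite (le_trans _ (fg 0 x)).
    apply: cvgr_to_le (cvg_norm (ff x)) _; last by apply: nearW => n; exact: fg.
  split=> //; apply/cvgr0Pnorm_le => e e0.
  pose t := e / (4 * (c + 1)).
  have c1 : 0 < c + 1 by rewrite ltr_wpDl.
  have t0 : 0 < t by rewrite divr_gt0// mulr_gt0.
  have tc : t * c <= e / 4.
    have -> : e / 4 = t * (c + 1) by rewrite /t; field; rewrite gt_eqF.
    by rewrite ler_pM2l// lerDl.
  have sc := sqnorm_cvg0 mf_ ff sg fg.
  have /cvgr0_norm_le sc0 : t^-1 * (c * sqnorm (fun x => f_ n x - f1 x)) @[n --> \oo] --> 0.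
    have := cvgM (@cvg_cst _ t^-1 _ \oo _) (cvgM (@cvg_cst _ c _ \oo _) sc).
    by rewrite !mulr0; exact.
  have [k _ /(_ k (leqnn k)) /= hk] := sc0 (e / 4) (divr_gt0 e0 (ltr0n _ 4)).
  have [sfk Lk] := Pf k.
  have e2 : 0 < e / 2 by rewrite divr_gt0.
  near=> m.
  have hm : `|L m (f_ k)| <= e / 2 by near: m; move/cvgr0_norm_le : Lk; apply.
  have sB := sqintB sfk sf1.
  have eqf : f1 = (fun x => -1 * (f_ k x - f1 x) + f_ k x).
    by apply/funext => x; ring.
  rewrite [in leLHS]eqf Llin// mulN1r.
  apply: le_trans (ler_normD _ _) _; rewrite normrN.
  have h := Lbd m t _ t0 sB.
  have := ler_norm (t^-1 * (c * sqnorm (fun x => f_ k x - f1 x))).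
  lra.
Unshelve. all: by end_near. Qed.

End Density.

(** * Tensor products as test functions on R^3 *)

Section Tensor.
Variable R : realType.
Implicit Types (a : 'I_3 -> R -> R) (x v : R * R * R) (s : seq 'I_3).

Definition tensor a x : R := a 0 x.1.1 * a 1 x.1.2 * a 2 x.2.

(** The factors of the iterated partial derivative of a tensor product.  Only
    the number of occurrences of each index matters, so that partial
    derivatives of a tensor product commute, by [mderive_perm]. *)
Definition mderive s a : 'I_3 -> R -> R :=
  fun k => derive1n (count_mem k s) (a k).

Lemma differentiable_coord (g : R -> R) x (p : R * R * R -> R) :
  differentiable p x -> derivable g (p x) 1 ->
  differentiable (g \o p) x.
Proof. by move=> dp /derivable1_diffP dg; exact: differentiable_comp. Qed.

Lemma differentiable_lin (V W : normedModType R) (f : V -> W) (y0 : V) :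
  linear f -> continuous f -> differentiable f y0.
Proof.
move=> lf cf; pose fM := GRing.isLinear.Build _ _ _ _ _ lf.
pose fL : {linear _ -> _} := HB.pack f fM.
exact: (@linear_differentiable _ _ _ fL).
Qed.

Lemma differentiable_fst (V W : normedModType R) (x0 : V * W) :
  differentiable (fst : V * W -> V) x0.
Proof. by apply: differentiable_lin => // y; exact: cvg_fst. Qed.

Lemma differentiable_snd (V W : normedModType R) (x0 : V * W) :
  differentiable (snd : V * W -> W) x0.
Proof. by apply: differentiable_lin => // y; exact: cvg_snd. Qed.

Lemma derive_scale (g : R -> R) (y c : R) : derivable g y 1 ->
  'D_c g y = c * derive1 g y.
Proof.
move=> /derivable1_diffP dg.
by rewrite deriveE// derive1E deriveE// -[in LHS](mulr1 c) linearZ.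
Qed.

Lemma differentiable_tensor a x : (forall i, smooth (a i)) ->
  differentiable (tensor a) x.
Proof.
move=> sa; have da i y : derivable (a i) y 1 by exact: smooth_derivable.
apply: differentiableM; first apply: differentiableM.
- apply: (differentiable_coord (p := fun x => x.1.1)) => //.
  by apply: differentiable_comp; exact: differentiable_fst.
- apply: (differentiable_coord (p := fun x => x.1.2)) => //.
  by apply: differentiable_comp; [exact: differentiable_fst|exact: differentiable_snd].
- by apply: (differentiable_coord (p := snd)) => //; exact: differentiable_snd.
Qed.

(** The i-th basis vector has a single nonzero coordinate, which selects one
    of the three terms of the product rule. *)
Lemma derive_tensor a x i : (forall i, smooth (a i)) ->
  'D_(basis_vec R i) (tensor a) x = tensor (mderive [:: i] a) x.
Proof.
move=> sa; have da k y : derivable (a k) y 1 by exact: smooth_derivable.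
pose v := basis_vec R i.
have d1 : is_derive x v (fun x => a 0 x.1.1) (v.1.1 * derive1 (a 0) x.1.1).
  apply: DeriveDef.
    apply: diff_derivable; apply: (differentiable_coord (p := fun x => x.1.1)) => //.
    by apply: differentiable_comp; exact: differentiable_fst.
  by rewrite -(derive_scale v.1.1 (da 0 x.1.1)).
have d2 : is_derive x v (fun x => a 1 x.1.2) (v.1.2 * derive1 (a 1) x.1.2).
  apply: DeriveDef.
    apply: diff_derivable; apply: (differentiable_coord (p := fun x => x.1.2)) => //.
    by apply: differentiable_comp; [exact: differentiable_fst|exact: differentiable_snd].
  by rewrite -(derive_scale v.1.2 (da 1 x.1.2)).
have d3 : is_derive x v (fun x => a 2 x.2) (v.2 * derive1 (a 2) x.2).
  apply: DeriveDef.
    apply: diff_derivable; apply: (differentiable_coord (p := snd)) => //.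
    exact: differentiable_snd.
  by rewrite -(derive_scale v.2 (da 2 x.2)).
have [_ ->] := is_deriveM (is_deriveM d1 d2) d3.
rewrite /tensor /mderive /v /basis_vec /GRing.scale/=.
case: i {v d1 d2 d3} => [[|[|[|i]]] hi] //=;
  rewrite !(mul0r, mul1r, mulr0, addr0, add0r).
- by ring.
- by ring.
- by [].
Qed.

Lemma smooth_derive1n n (g : R -> R) : smooth g -> smooth (derive1n n g).
Proof. by move=> sg; elim: n => // n IH; rewrite derive1nS; exact: smooth_derive1. Qed.

Lemma bump_derive1n n (g : R -> R) : bump_fun g -> bump_fun (derive1n n g).
Proof. by move=> sg; elim: n => // n IH; rewrite derive1nS; exact: bump_derive1. Qed.

Lemma mderive_cat s s' a : mderive (s ++ s') a = mderive s (mderive s' a).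
Proof.
by apply/funext => k; rewrite /mderive count_cat /derive1n iterD.
Qed.

Lemma mderive_perm s s' a : perm_eq s s' -> mderive s a = mderive s' a.
Proof. by move=> /permP h; apply/funext => k; rewrite /mderive h. Qed.

Lemma partial_tensor s a : (forall i, smooth (a i)) ->
  partial s (tensor a) = tensor (mderive s a).
Proof.
move=> sa; elim: s => // i s IH; apply/funext => x /=.
rewrite IH derive_tensor; first by rewrite -mderive_cat.
by move=> k; exact: smooth_derive1n.
Qed.

Lemma test_function_tensor a : (forall i, bump_fun (a i)) ->
  test_function (tensor a).
Proof.
move=> ba; split.
  move=> s x; rewrite partial_tensor; last by move=> i; case: (ba i).
  by apply: differentiable_tensor => i; apply: smooth_derive1n; case: (ba i).
have [_ [M0 h0]] := ba 0; have [_ [M1 h1]] := ba 1; have [_ [M2 h2]] := ba 2.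
pose K : set (R * R * R) := (`[-M0, M0] `*` `[-M1, M1]) `*` `[-M2, M2].
have cK : compact K.
  by apply: compact_setX; [apply: compact_setX|]; exact: segment_compact.
apply: subclosed_compact (cK) _; first exact: closed_closure.
have -> : K = closure K.
  by apply/closure_id; apply: compact_closed.
apply: closureS => x /= /eqP hx.
have hb (M y : R) (g : R -> R) : (forall t, M < `|t| -> g t = 0) -> g y <> 0 ->
    `[-M, M]%classic y.
  move=> hg gy; rewrite /= in_itv/= -ler_norml leNgt; apply/negP => /hg.
  by [].
split; first split.
- by apply: hb h0 _ => e; apply: hx; rewrite /tensor e !mul0r.
- by apply: hb h1 _ => e; apply: hx; rewrite /tensor e mulr0 mul0r.
- by apply: hb h2 _ => e; apply: hx; rewrite /tensor e mulr0.
Qed.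

End Tensor.

(** * Convolution kernels *)

Section ProductIntegral.
Context d1 d2 (T1 : measurableType d1) (T2 : measurableType d2) (R : realType).
Variables (m1 : {sigma_finite_measure set T1 -> \bar R})
  (m2 : {sigma_finite_measure set T2 -> \bar R}).

Lemma integral_prodM (f : T1 -> R) (g : T2 -> R) :
  measurable_fun setT f -> measurable_fun setT g ->
  (forall x, 0 <= f x) -> (forall y, 0 <= g y) ->
  (\int[(m1 \x m2)]_p (f p.1 * g p.2)%:E =
    \int[m1]_x (f x)%:E * \int[m2]_y (g y)%:E)%E.
Proof.
move=> mf mg f0 g0.
have mfg : measurable_fun setT (fun p : T1 * T2 => (f p.1 * g p.2)%:E).
  apply/measurable_EFinP/measurable_funM; first exact: measurableT_comp mf _.
  exact: measurableT_comp mg _.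
rewrite fubini_tonelli1//=; last by move=> p; rewrite lee_fin mulr_ge0.
rewrite -ge0_integralZr//; last 3 first.
- exact/measurable_EFinP.
- by move=> x _; rewrite lee_fin.
- by apply: integral_ge0 => y _; rewrite lee_fin.
apply: eq_integral => x _; rewrite /fubini_F/=; under eq_integral do rewrite EFinM.
rewrite ge0_integralZl//.
- exact/measurable_EFinP.
- by move=> y _; rewrite lee_fin.
- by rewrite lee_fin.
Qed.

End ProductIntegral.

Section Kernels.
Variable R : realType.
Implicit Types (a : 'I_3 -> R -> R) (z x : R * R * R).
Local Notation lambda := (@lebesgue_measure R).

Lemma integral_tensor (a : 'I_3 -> R -> R) :
  (forall i, measurable_fun setT (a i)) -> (forall i t, 0 <= a i t) ->
  (\int[@leb3 R]_x (tensor a x)%:E = \int[lambda]_t (a 0 t)%:E *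
    \int[lambda]_t (a 1 t)%:E * \int[lambda]_t (a 2 t)%:E)%E.
Proof.
move=> ma a0.
pose f (y : measurableTypeR R * measurableTypeR R) := a 0 y.1 * a 1 y.2.
have mf : measurable_fun setT f.
  apply: measurable_funM; first exact: measurableT_comp (ma 0) _.
  exact: measurableT_comp (ma 1) _.
have := @integral_prodM _ _ _ _ _ (@leb2 R) lambda f (a 2) mf (ma 2)
  (fun p => mulr_ge0 (a0 _ _) (a0 _ _)) (a0 2).
move=> ->; congr (_ * _)%E.
exact: (@integral_prodM _ _ _ _ _ lambda lambda _ _ (ma 0) (ma 1) (a0 0) (a0 1)).
Qed.

Lemma measurable_tensor a : (forall i, measurable_fun setT (a i)) ->
  measurable_fun (setT : set (mR3 R)) (tensor a).
Proof.
move=> ma; apply: measurable_funM; first apply: measurable_funM.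
- apply: measurableT_comp (ma 0) _; apply: measurableT_comp => //.
- apply: measurableT_comp (ma 1) _; apply: measurableT_comp => //.
- apply: measurableT_comp (ma 2) _ => //.
Qed.

Lemma measurable_bump (g : R -> R) : bump_fun g -> measurable_fun setT g.
Proof.
by move=> [sg _]; apply: continuous_measurable_fun; exact: smooth_continuous.
Qed.

(** The kernel of the convolution by the tensor product.  With the second
    variable fixed it is a translate of the tensor product, with the first one
    fixed a reflection; both are again tensor products of bumps, hence test
    functions. *)
Definition diff_kernel a (p : (R * R * R) * (R * R * R)) : R :=
  tensor a (p.1 - p.2).

Definition coord (i : 'I_3) x : R :=
  if i == 0 then x.1.1 else if i == 1 then x.1.2 else x.2.

Definition translate a x : 'I_3 -> R -> R :=
  fun i t => a i (t - coord i x).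

Definition reflect3 a z : 'I_3 -> R -> R :=
  fun i t => a i (coord i z - t).

Lemma measurable_diff_kernel a : (forall i, measurable_fun setT (a i)) ->
  measurable_fun (setT : set (mR3 R * mR3 R)) (diff_kernel a).
Proof.
move=> ma; apply: measurable_funM; first apply: measurable_funM.
- apply: measurableT_comp (ma 0) _; apply: measurable_funB;
    do 3 apply: measurableT_comp => //.
- apply: measurableT_comp (ma 1) _; apply: measurable_funB;
    do 3 apply: measurableT_comp => //.
- apply: measurableT_comp (ma 2) _; apply: measurable_funB;
    do 2 apply: measurableT_comp => //.
Qed.

Lemma bump_translate a x i : (forall i, bump_fun (a i)) ->
  bump_fun (translate a x i).
Proof.
move=> ba; have := @bump_comp_affine _ (a i) 1 (- coord i x) (normr1 _) (ba i).
by congr bump_fun; apply/funext => t; rewrite mul1r.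
Qed.

Lemma bump_reflect a z i : (forall i, bump_fun (a i)) ->
  bump_fun (reflect3 a z i).
Proof.
move=> ba; have := @bump_comp_affine _ (a i) (-1) (coord i z) (normrN1 _) (ba i).
by congr bump_fun; apply/funext => t; rewrite mulN1r addrC.
Qed.

Lemma derive1_translate (g : R -> R) (c : R) : (forall t : R, derivable g t 1) ->
  derive1 (fun t => g (t - c)) = fun t => derive1 g (t - c).
Proof.
move=> dg; apply: derive1_eq => t.
have := @is_derive_comp_affine _ g 1 (- c) t; rewrite !mul1r => /(_ (dg _)).
by congr (is_derive _ _ _ _); apply/funext => u; rewrite mul1r.
Qed.

Lemma derive1_reflect (g : R -> R) (c : R) : (forall t : R, derivable g t 1) ->
  derive1 (fun t => g (c - t)) = fun t => - derive1 g (c - t).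
Proof.
move=> dg; apply: derive1_eq => t.
have := @is_derive_comp_affine _ g (-1) c t; rewrite !mulN1r (addrC _ c) => /(_ (dg _)).
by congr (is_derive _ _ _ _); apply/funext => u; rewrite mulN1r addrC.
Qed.

Lemma mderive1_translate m a x : (forall i, bump_fun (a i)) ->
  mderive [:: m] (translate a x) = translate (mderive [:: m] a) x.
Proof.
move=> ba; apply/funext => i; rewrite /mderive /translate/= addn0.
case: eqP => //= _; rewrite derive1_translate// => t.
by apply: smooth_derivable; case: (ba i).
Qed.

(** Only the differentiated factor changes sign under the reflection. *)
Lemma tensor_mderive1_reflect m a z x : (forall i, bump_fun (a i)) ->
  tensor (mderive [:: m] (reflect3 a z)) x =
  - tensor (reflect3 (mderive [:: m] a) z) x.
Proof.
move=> ba; have da i t : derivable (a i) t 1.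
  by apply: smooth_derivable; case: (ba i).
rewrite /tensor /mderive /reflect3/= !addn0.
by case: m => [[|[|[|m]]] hm] //=; rewrite derive1_reflect// ?(mulrN, mulNr).
Qed.

Lemma bump_mderive s a i : (forall i, bump_fun (a i)) -> bump_fun (mderive s a i).
Proof. by move=> ba; exact: bump_derive1n. Qed.

Lemma bump_mass (g : R -> R) : bump_fun g ->
  (\int[lambda]_t `|g t|%:E = (\int[lambda]_t `|g t|)%:E)%E.
Proof.
move=> bg; rewrite /Rintegral fineK//.
by have /integrable_norm/integrable_fin_num := bump_integrable bg; apply.
Qed.

(** The L1 norm of the tensor product. *)
Definition mass a : R := \int[lambda]_t `|a 0 t| * \int[lambda]_t `|a 1 t| *
  \int[lambda]_t `|a 2 t|.

Lemma integral_abs_tensor a : (forall i, bump_fun (a i)) ->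
  (\int[@leb3 R]_x `|tensor a x|%:E = (mass a)%:E)%E.
Proof.
move=> ba.
rewrite (eq_integral (fun x : mR3 R => (tensor (fun i t => `|a i t|) x)%:E)); last first.
  by move=> x _; rewrite /tensor !normrM.
rewrite integral_tensor//; first by rewrite !bump_mass// !EFinM.
by move=> i; apply: measurableT_comp => //; exact: measurable_bump.
Qed.

Lemma integrable_tensor a : (forall i, bump_fun (a i)) ->
  (@leb3 R).-integrable setT (EFin \o tensor a).
Proof.
move=> ba; apply/integrableP; split; last by rewrite integral_abs_tensor// ltry.
by apply/measurable_EFinP; apply: measurable_tensor => i; exact: measurable_bump.
Qed.

Lemma mass_translate a x : (forall i, bump_fun (a i)) -> mass (translate a x) = mass a.
Proof.
move=> ba; have h i c : \int[lambda]_t `|a i (t - c)| = \int[lambda]_t `|a i t|.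
  rewrite /Rintegral (@integral_shift _ (fun t => `|a i t|%:E))//.
  by apply/measurable_EFinP/measurableT_comp => //; exact: measurable_bump.
by rewrite /mass /translate !h.
Qed.

Lemma mass_reflect a z : (forall i, bump_fun (a i)) -> mass (reflect3 a z) = mass a.
Proof.
move=> ba; have h i c : \int[lambda]_t `|a i (c - t)| = \int[lambda]_t `|a i t|.
  rewrite /Rintegral (@integral_reflect _ (fun t => `|a i t|%:E))//.
  by apply/measurable_EFinP/measurableT_comp => //; exact: measurable_bump.
by rewrite /mass /reflect3 !h.
Qed.

Lemma schur_diff_kernel a : (forall i, bump_fun (a i)) ->
  schur_kernel (@leb3 R) (mass a) (diff_kernel a).
Proof.
move=> ba; split.
- by apply: measurable_diff_kernel => i; exact: measurable_bump.
- move=> z; rewrite -(mass_reflect z ba) -integral_abs_tensor// => i.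
  exact: bump_reflect.
- move=> x; rewrite -(mass_translate x ba) -integral_abs_tensor// => i.
  exact: bump_translate.
Qed.

Lemma sqint_tensor a : (forall i, bump_fun (a i)) -> sqint (@leb3 R) (tensor a).
Proof.
move=> ba; have mt : measurable_fun (setT : set (mR3 R)) (tensor a).
  by apply: measurable_tensor => i; exact: measurable_bump.
split=> //; apply/integrableP; split; first exact/measurable_EFinP/measurable_funX.
pose b i t := a i t ^+ 2.
have bb i : bump_fun (b i).
  have [sa [M aM]] := ba i; split; first exact: smoothM.
  by exists M => t /aM e; rewrite /b e expr0n.
rewrite (eq_integral (fun x : mR3 R => `|tensor b x|%:E)); last first.
  by move=> x _ /=; rewrite /tensor /b !exprMn.
by rewrite integral_abs_tensor// ltry.
Qed.

End Kernels.

(** * Sets that are locally constant from the left *)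

Section LeftConstant.
Variable R : realType.
Implicit Types (E : set (mR3 R)).

(** E does not change between z and the points of a small open box below z in
    all three coordinates.  Half-open boxes ]a, b] x ]c, d] x ]e, f] have this
    property at every point, boundary included, and they generate the Borel
    sets. *)
Definition left_constant E := measurable E /\ forall z : R * R * R,
  exists2 e : R, 0 < e & forall x : R * R * R,
    (forall i, 0 < coord i z - coord i x < e) -> (E x <-> E z).

Lemma left_constantI : setI_closed left_constant.
Proof.
move=> E F [mE hE] [mF hF]; split; first exact: measurableI.
move=> z; have [e e0 he] := hE z; have [f f0 hf] := hF z.
exists (Num.min e f) => [|x hx]; first by rewrite lt_min e0 f0.
split=> -[Ex Fx]; split.
- apply/(he x) => // i; have := hx i; rewrite lt_min => /andP[->/andP[->//]].
- apply/(hf x) => // i; have := hx i; rewrite lt_min => /andP[->/andP[_ ->//]].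
- apply/(he x) => // i; have := hx i; rewrite lt_min => /andP[->/andP[->//]].
- apply/(hf x) => // i; have := hx i; rewrite lt_min => /andP[->/andP[_ ->//]].
Qed.

Lemma left_constant_measurable : left_constant `<=` measurable.
Proof. by move=> E []. Qed.

Lemma measurable_coord (i : 'I_3) :
  measurable_fun (setT : set (mR3 R)) (coord i : mR3 R -> measurableTypeR R).
Proof.
rewrite /coord; case: (i == 0) => /=; last case: (i == 1) => /=.
- by apply: measurableT_comp.
- by apply: measurableT_comp.
- exact: (@measurable_snd _ _
    (measurableTypeR R * measurableTypeR R)%type (measurableTypeR R)).
Qed.

Lemma left_constant_coord (i : 'I_3) (a b : R) :
  left_constant (coord i @^-1` `]a, b]%classic).
Proof.
split.
  rewrite -[X in measurable X]setTI; apply: measurable_coord => //.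
move=> z; have [za|az] := leP (coord i z) a.
  exists 1 => // x /(_ i) /andP[zx _]; rewrite /= !in_itv/=.
  by split=> /andP[]; lra.
have [zb|bz] := leP (coord i z) b.
  exists (coord i z - a); first by rewrite subr_gt0.
  move=> x /(_ i) /andP[zx xa]; rewrite /= !in_itv/=.
  by split=> _; apply/andP; split; lra.
exists (coord i z - b); first by rewrite subr_gt0.
move=> x /(_ i) /andP[zx xa]; rewrite /= !in_itv/=.
by split=> /andP[]; lra.
Qed.

(** The coordinates are measurable for the sigma-algebra generated by the
    left-constant sets, so the identity map into the product is too. *)
Lemma measurable_left_constant :
  (measurable : set (set (mR3 R))) `<=` <<s left_constant >>.
Proof.
pose S := g_sigma_algebraType left_constant.
have mc i : measurable_fun (setT : set S) (coord i : S -> measurableTypeR R).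
  apply: (@measurability _ _ S (measurableTypeR R) _ _ (@ocitv R)) => //.
  move=> _ [_ [[a b] _ <-] <-]; rewrite setTI; apply: sub_sigma_algebra.
  exact: left_constant_coord.
have mid : measurable_fun (setT : set S) (fun x : S => (x : mR3 R)).
  have -> : (fun x : S => (x : mR3 R)) =
      (fun x => ((coord 0 x, coord 1 x), coord 2 x) : mR3 R).
    by apply/funext => -[[x y] z].
  apply: measurable_fun_pair; last exact: (mc 2).
  by apply: measurable_fun_pair; [exact: (mc 0)|exact: (mc 1)].
by move=> E mE; have := mid measurableT E mE; rewrite setTI.
Qed.

Definition cube (n : nat) : set (mR3 R) :=
  (`]- n%:R, n%:R] `*` `]- n%:R, n%:R]) `*` `]- n%:R, n%:R].

Lemma left_constant_cube n : left_constant (cube n).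
Proof.
have -> : cube n = coord 0 @^-1` `]- n%:R, n%:R]%classic `&`
    coord 1 @^-1` `]- n%:R, n%:R]%classic `&` coord 2 @^-1` `]- n%:R, n%:R]%classic.
  by [].
by apply: left_constantI; [apply: left_constantI|]; exact: left_constant_coord.
Qed.

Lemma cube_nd : nondecreasing_seq cube.
Proof.
move=> m n mn; apply/subsetPset.
have h : `]- m%:R, m%:R]%classic `<=` (`]- n%:R, n%:R]%classic : set R).
  move=> x /=; rewrite !in_itv/= => /andP[x1 x2].
  have : m%:R <= n%:R :> R by rewrite ler_nat.
  by move=> mnR; apply/andP; split; lra.
by move=> [[x y] z] /= [[hx hy] hz]; split; [split|]; apply: h.
Qed.

Lemma bigcup_cube : \bigcup_n cube n = setT.
Proof.
apply/seteqP; split => // -[[x y] z] _.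
pose M := `|x| + `|y| + `|z|.
have [n Mn] : exists n : nat, M < n%:R.
  by exists (Num.truncn M).+1; rewrite truncnS_gt// !addr_ge0.
have h t : `|t| <= M -> `]- n%:R, n%:R]%classic t.
  move=> tM; have : `|t| < n%:R by apply: le_lt_trans Mn.
  by rewrite ltr_norml /= in_itv/= => /andP[-> /ltW ->].
exists n => //; split; first split; apply: h; rewrite /M/=.
- by rewrite -addrA lerDl addr_ge0.
- by rewrite addrAC lerDr addr_ge0.
- by rewrite lerDr addr_ge0.
Qed.

Lemma cube_finite n : (@leb3 R (cube n) < +oo)%E.
Proof.
pose I : set (measurableTypeR R) := `]- n%:R, n%:R]%classic.
have mI : measurable I by exact: measurable_itv.
have Ioo : (lebesgue_measure I < +oo)%E.
  by rewrite /I lebesgue_measure_itv/=; case: ifP => _; rewrite -?EFinB ltry.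
have -> : @leb3 R (cube n) = (@leb2 R (I `*` I) * lebesgue_measure I)%E.
  by apply: product_measure1E => //; exact: measurableX.
have -> : @leb2 R (I `*` I) = (lebesgue_measure I * lebesgue_measure I)%E.
  exact: product_measure1E.
have Ifin : lebesgue_measure I \is a fin_num by rewrite ge0_fin_numE.
by rewrite lte_mul_pinfty ?fin_numM ?mule_ge0.
Qed.

End LeftConstant.

(** * Limits of the averaged correlations *)

Lemma ord3P (i : 'I_3) : [\/ i = 0, i = 1 | i = 2].
Proof.
by case: i => [[|[|[|i]]] hi] //; [apply: Or31|apply: Or32|apply: Or33];
  exact: val_inj.
Qed.

Section Approximation.
Variable R : realType.
Local Notation lambda := (@lebesgue_measure R).
Local Notation sqint := (@sqint _ _ _ (@leb3 R)).
Local Notation sqnorm := (@sqnorm _ _ _ (@leb3 R)).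
Implicit Types (A B : R * R * R -> R).

Lemma diff_kernel_fubini1 a A B : (forall i, bump_fun (a i)) ->
  sqint A -> sqint B -> kform (@leb3 R) (diff_kernel a) A B =
  \int[@leb3 R]_z (A z * \int[@leb3 R]_x (B x * tensor (reflect3 a z) x)).
Proof.
move=> ba sA sB; apply: (kform_fubini1 (schur_diff_kernel ba)) => // z.
by apply: (@sqint_tensor R (reflect3 a z)) => i; exact: bump_reflect.
Qed.

Lemma diff_kernel_fubini2 a A B : (forall i, bump_fun (a i)) ->
  sqint A -> sqint B -> kform (@leb3 R) (diff_kernel a) A B =
  \int[@leb3 R]_x (B x * \int[@leb3 R]_z (A z * tensor (translate a x) z)).
Proof.
move=> ba sA sB; apply: (kform_fubini2 (schur_diff_kernel ba)) => // x.
by apply: (@sqint_tensor R (translate a x)) => i; exact: bump_translate.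
Qed.

Lemma sqint_cvg0_R3 (L : nat -> (R * R * R -> R) -> R) (c : R) :
  (forall n a f g, sqint f -> sqint g ->
    L n (fun x => a * f x + g x) = a * L n f + L n g) ->
  (forall n (t : R) f, 0 < t -> sqint f -> `|L n f| <= t * c + t^-1 * (c * sqnorm f)) ->
  (forall E n, left_constant E -> E `<=` cube n -> L m \1_E @[m --> \oo] --> 0) ->
  forall f, sqint f -> L m f @[m --> \oo] --> 0.
Proof.
apply: (@sqint_cvg0 _ _ _ (@leb3 R) (@left_constant R) (@cube R) L c).
- exact: left_constantI.
- exact: left_constant_measurable.
- exact: measurable_left_constant.
- exact: left_constant_cube.
- exact: cube_nd.
- exact: bigcup_cube.
- exact: cube_finite.
Qed.

Lemma cube_measurable n : measurable (@cube R n).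
Proof. exact: (left_constant_measurable (left_constant_cube R n)). Qed.

Lemma sqint_left_constant E n : left_constant E -> E `<=` @cube R n ->
  sqint \1_E.
Proof.
move=> [mE _] En; apply: sqint_indic => //.
apply: le_lt_trans (@cube_finite R n); apply: le_measure => //; rewrite inE//.
exact: cube_measurable.
Qed.

(** For kernels of mass 1 whose support shrinks to the origin from the positive
    side (l = 1), or escapes to infinity (l = 0), the averages converge to
    l * int A B.  The hypothesis [supp_a] covers both cases: seen from a given
    point z, the kernel of index n large charges only points x at which the
    indicator of E takes the value l * 1_E(z). *)
Section Limit.
Variables (a : nat -> 'I_3 -> R -> R) (l : R).
Hypothesis l01 : 0 <= l <= 1.
Hypothesis ba : forall n i, bump_fun (a n i).
Hypothesis a0 : forall n i t, 0 <= a n i t.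
Hypothesis a1 : forall n i, \int[lambda]_t a n i t = 1.
Hypothesis supp_a : forall E m, left_constant E -> E `<=` @cube R m ->
  forall z, \forall n \near \oo, forall x : R * R * R,
  (forall i, a n i (coord i z - coord i x) != 0) -> \1_E x = l * \1_E z :> R.

Let L n A B : R :=
  kform (@leb3 R) (diff_kernel (a n)) A B - l * \int[@leb3 R]_x (A x * B x).

Let mass1 n : mass (a n) = 1.
Proof.
have h i : \int[lambda]_t `|a n i t| = 1.
  by rewrite -[RHS](a1 n i); apply: eq_Rintegral => t _; rewrite ger0_norm.
by rewrite /mass !h !mulr1.
Qed.

Let schur1 n : schur_kernel (@leb3 R) 1 (diff_kernel (a n)).
Proof. by rewrite -(mass1 n); exact: schur_diff_kernel. Qed.

Let L_bound n (t : R) A B : 0 < t -> sqint A -> sqint B ->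
  `|L n A B| <= t * (2 * sqnorm A) + t^-1 * (2 * sqnorm B).
Proof.
move=> t0 sA sB; have h1 := kform_le (schur1 n) t0 sA sB.
have h2 := Rintegral_mul_le t0 sA sB.
apply: le_trans (ler_normB _ _) _; rewrite normrM.
have /andP[l0 l1] := l01; rewrite (ger0_norm l0).
have h3 : l * `|\int[@leb3 R]_x (A x * B x)| <= `|\int[@leb3 R]_x (A x * B x)|.
  by rewrite ler_piMl.
rewrite mul1r in h1.
have -> : t * (2 * sqnorm A) + t^-1 * (2 * sqnorm B) =
  t * sqnorm A + t^-1 * sqnorm B + (t * sqnorm A + t^-1 * sqnorm B) by ring.
by apply: lerD h1 _; exact: le_trans h3 h2.
Qed.

Let L_linl n c A A' B : sqint A -> sqint A' -> sqint B ->
  L n (fun x => c * A x + A' x) B = c * L n A B + L n A' B.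
Proof.
move=> sA sA' sB; rewrite /L (kformDl _ (schur1 n))//.
have I := integrableM_sqint sA sB; have I' := integrableM_sqint sA' sB.
have -> : \int[@leb3 R]_x ((c * A x + A' x) * B x) =
    c * \int[@leb3 R]_x (A x * B x) + \int[@leb3 R]_x (A' x * B x).
  rewrite -RintegralZl// -RintegralD//; last exact: (integrableZl _ c I).
  by apply: eq_Rintegral => x _; ring.
by ring.
Qed.

Let L_linr n c A B B' : sqint A -> sqint B -> sqint B' ->
  L n A (fun x => c * B x + B' x) = c * L n A B + L n A B'.
Proof.
move=> sA sB sB'; rewrite /L (kformDr _ (schur1 n))//.
have I := integrableM_sqint sA sB; have I' := integrableM_sqint sA sB'.
have -> : \int[@leb3 R]_x (A x * (c * B x + B' x)) =
    c * \int[@leb3 R]_x (A x * B x) + \int[@leb3 R]_x (A x * B' x).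
  rewrite -RintegralZl// -RintegralD//; last exact: (integrableZl _ c I).
  by apply: eq_Rintegral => x _; ring.
by ring.
Qed.

Let mean_reflect n z : \int[@leb3 R]_x tensor (reflect3 (a n) z) x = 1.
Proof.
rewrite -(mass1 n) -(mass_reflect z (ba n)) /Rintegral.
have -> : mass (reflect3 (a n) z) = fine (mass (reflect3 (a n) z))%:E by [].
rewrite -integral_abs_tensor; last by move=> i; exact: bump_reflect _ _ (ba n).
congr fine; apply: eq_integral => x _; congr EFin.
by rewrite ger0_norm// /tensor /reflect3 !mulr_ge0.
Qed.

(* The mean h m z of 1_F seen from z is eventually equal to l * 1_F(z), and
   1_E dominates, so that dominated convergence applies. *)
Let L_indic E F n : left_constant E -> E `<=` @cube R n ->
  left_constant F -> F `<=` @cube R n -> L m \1_E \1_F @[m --> \oo] --> 0.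
Proof.
move=> lE En lF Fn.
have sE := sqint_left_constant lE En; have sF := sqint_left_constant lF Fn.
have mE := left_constant_measurable lE.
rewrite -(subrr (l * \int[@leb3 R]_x (\1_E x * \1_F x))).
apply: cvgB; last exact: cvg_cst.
pose h m z := \int[@leb3 R]_x (\1_F x * tensor (reflect3 (a m) z) x).
rewrite (_ : (fun m => _) =
    (fun m => \int[@leb3 R]_z (\1_E z * h m z))); last first.
  by apply/funext => m; exact: diff_kernel_fubini1.
have IEF := integrableM_sqint sE sF.
rewrite -RintegralZl//.
have h01 m z : 0 <= h m z <= 1.
  have t0 x : 0 <= tensor (reflect3 (a m) z) x by rewrite /tensor /reflect3 !mulr_ge0.
  have It : (@leb3 R).-integrable setT (EFin \o tensor (reflect3 (a m) z)).
    by apply: integrable_tensor => i; exact: bump_reflect.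
  apply/andP; split.
    by apply: Rintegral_ge0 => x _; rewrite mulr_ge0.
  rewrite -(mean_reflect m z); apply: le_Rintegral => //.
    apply: integrableM_sqint => //; apply: sqint_tensor => i.
    exact: bump_reflect _ _ (ba m).
  by move=> x _; rewrite ler_piMl// indicE; case: (_ \in _).
apply: (@dominated_cvg_Rintegral _ _ _ _ _ _ \1_E).
- move=> m; apply: measurable_funM; first exact: measurable_indic.
  pose f (p : mR3 R * mR3 R) := (\1_F p.2 * diff_kernel (a m) p)%:E.
  have mf : measurable_fun setT f.
    apply/measurable_EFinP/measurable_funM; last by have [] := schur1 m.
    apply: measurableT_comp => //; apply: measurable_indic.
    exact: left_constant_measurable.
  have f0 p : (0 <= f p)%E.
    by rewrite lee_fin /diff_kernel /tensor !mulr_ge0.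
  have := @measurable_fun_fubini_tonelli_F _ _ _ _ _ (@leb3 R) f mf f0.
  by apply: measurableT_comp; exact: fine_measurable.
- move=> z.
  apply: (@cvg_near_cst _ _ _ _ _ eventually_filter).
  have := supp_a lF Fn z; apply: filterS => m hm.
  have -> : h m z = l * \1_F z; last by ring.
  rewrite -[RHS]mulr1 -(mean_reflect m z) /h -RintegralZl//; last first.
    by apply: integrable_tensor => i; exact: bump_reflect.
  apply: eq_Rintegral => x _.
  have [->|] := eqVneq (tensor (reflect3 (a m) z) x) 0; first by rewrite !mulr0.
  rewrite /tensor !mulf_eq0 !negb_or => /andP[/andP[n0 n1] n2].
  by rewrite (hm x)// => i; case: (ord3P i) => ->.
- have [_] := sE; apply: eq_integrable => // x _ /=.
  by rewrite indicE; case: (_ \in _); rewrite ?expr1n ?expr0n.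
- move=> m z; have /andP[h0 h1] := h01 m z.
  by rewrite normrM !ger0_norm// ler_piMr.
Qed.

(** The density principle is applied first in B, which leaves indicators in
    the second argument, and then in A. *)
Lemma kform_cvg A B : sqint A -> sqint B ->
  kform (@leb3 R) (diff_kernel (a n)) A B @[n --> \oo] -->
    l * \int[@leb3 R]_x (A x * B x).
Proof.
move=> sA sB; apply/subr_cvg0; rewrite -/(L _ _ _).
move: B sB; apply: (@sqint_cvg0_R3 (fun n B => L n A B) (2 + 2 * sqnorm A)).
- by move=> n c f g sf sg; exact: L_linr.
- move=> n t f t0 sf; apply: le_trans (L_bound n t0 sA sf) _.
  have ti0 : 0 < t^-1 by rewrite invr_gt0.
  have := sqnorm_ge0 (@leb3 R) A; have := sqnorm_ge0 (@leb3 R) f => f0 A0.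
  apply: lerD; rewrite ler_pM2l//; first by rewrite lerDr.
  by apply: ler_wpM2r => //; rewrite lerDl mulr_ge0.
move=> F n lF Fn; have sF := sqint_left_constant lF Fn.
move: A sA; apply: (@sqint_cvg0_R3 (fun n A => L n A \1_F) (2 + 2 * sqnorm \1_F)).
- by move=> k c f g sf sg; exact: L_linl.
- move=> k t f t0 sf; have ti0 : 0 < t^-1 by rewrite invr_gt0.
  apply: le_trans (L_bound k ti0 sf sF) _; rewrite invrK addrC.
  have := sqnorm_ge0 (@leb3 R) (\1_F); have := sqnorm_ge0 (@leb3 R) f => f0 A0.
  apply: lerD; rewrite ler_pM2l//; first by rewrite lerDr.
  by apply: ler_wpM2r => //; rewrite lerDl mulr_ge0.
move=> E m lE Em; apply: (@L_indic E F (maxn m n)) => //.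
  by apply: subset_trans Em _; apply/subsetPset; apply: cube_nd; exact: leq_maxl.
by apply: subset_trans Fn _; apply/subsetPset; apply: cube_nd; exact: leq_maxr.
Qed.

End Limit.
End Approximation.

(** * Mollifiers near the origin and far away *)

Section MollifierKernels.
Variable R : realType.
Local Notation sqint := (@sqint _ _ _ (@leb3 R)).
Implicit Types (A B : R * R * R -> R).

Definition width (n : nat) : R := n.+1%:R^-1.

Definition near_mollifier (n : nat) : 'I_3 -> R -> R := fun=> ubump (width n).

Definition far_mollifier (n : nat) : 'I_3 -> R -> R := fun i t =>
  if i == 0 then ubump (width n) (t - n%:R) else ubump (width n) t.

(** Its first partial derivative is the near mollifier minus the far one, by
    [derive1_plateau]. *)
Definition transport (n : nat) : 'I_3 -> R -> R := fun i =>
  if i == 0 then plateau (width n) n%:R else ubump (width n).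

Lemma width_gt0 n : 0 < width n.
Proof. by rewrite invr_gt0. Qed.

Lemma bump_transport n i : bump_fun (transport n i).
Proof.
rewrite /transport; case: ifP => _; last exact: bump_ubump.
exact/bump_plateau/width_gt0.
Qed.

Lemma bump_near n i : bump_fun (near_mollifier n i).
Proof. exact: bump_ubump. Qed.

Lemma bump_far n i : bump_fun (far_mollifier n i).
Proof.
rewrite /far_mollifier; case: (i == 0); last exact: bump_ubump.
have := @bump_comp_affine R _ 1 (- n%:R) (normr1 _) (bump_ubump (width n)).
by congr bump_fun; apply/funext => t; rewrite mul1r.
Qed.

Lemma diff_kernel_transport n p : diff_kernel (mderive [:: 0] (transport n)) p =
  diff_kernel (near_mollifier n) p - diff_kernel (far_mollifier n) p.
Proof.
rewrite /diff_kernel /tensor /mderive /transport /near_mollifier /far_mollifier /=.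
by rewrite derive1_plateau; ring.
Qed.

Lemma kform_near A B : sqint A -> sqint B ->
  kform (@leb3 R) (diff_kernel (near_mollifier n)) A B @[n --> \oo] -->
  \int[@leb3 R]_x (A x * B x).
Proof.
move=> sA sB; rewrite -[X in _ --> X]mul1r; apply: kform_cvg => //.
- by rewrite ler01 lexx.
- by move=> n i; exact: bump_near.
- by move=> n i t; exact: ubump_ge0.
- by move=> n i; exact/ubump_mass/width_gt0.
move=> E m [mE hE] Em z; have [e e0 he] := hE z.
have := near_infty_natSinv_lt (PosNum e0); apply: filterS => n /= ne x hx.
rewrite mul1r !indicE; congr (_%:R); congr nat_of_bool.
have exz : E x <-> E z.
  apply: he => i; have := hx i; apply: contraNT => hi.
  rewrite /near_mollifier ubump_supp//; apply: contra hi => /andP[-> h] /=.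
  exact: lt_trans h ne.
by apply/idP/idP => /set_mem /exz /mem_set.
Qed.

Lemma kform_far A B : sqint A -> sqint B ->
  kform (@leb3 R) (diff_kernel (far_mollifier n)) A B @[n --> \oo] --> 0.
Proof.
move=> sA sB; rewrite -(mul0r (\int[@leb3 R]_x (A x * B x))); apply: kform_cvg => //.
- by rewrite lexx ler01.
- by move=> n i; exact: bump_far.
- by move=> n i t; rewrite /far_mollifier; case: (i == 0); exact: ubump_ge0.
- move=> n i; have h := ubump_mass (width_gt0 n).
  rewrite /far_mollifier; case: (i == 0) => //; rewrite -[RHS]h /Rintegral.
  rewrite (@integral_shift _ (fun t => (ubump (width n) t)%:E))//.
    by apply/measurable_EFinP; apply: measurable_bump; exact: bump_ubump.
  by move=> t; rewrite lee_fin; exact: ubump_ge0.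
move=> E m [mE hE] Em z.
have := nbhs_infty_ger (coord 0 z + m%:R); apply: filterS => n /= ne x hx.
rewrite mul0r indicE memNset// => /Em [[/= x0 _] _].
have := hx 0; rewrite /far_mollifier /= ubump_supp ?eqxx//.
apply/negP => /andP[h _]; move: x0; rewrite in_itv/= => /andP[x0 _].
by move: h ne x0; rewrite /coord/=; lra.
Qed.

End MollifierKernels.

(** * Divergence-free gradients are orthogonal to Hessians *)

Section Orthogonality.
Variable R : realType.
Local Notation sqint := (@sqint _ _ _ (@leb3 R)).
Local Notation "'K[ a ]" := (kform (@leb3 R) (diff_kernel a)) (at level 0).
Variables (A H : 'I_3 -> 'I_3 -> R * R * R -> R).
Variables (u : 'I_3 -> R * R * R -> R) (f : R * R * R -> R).
Hypothesis sA : forall i j, sqint (A i j).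
Hypothesis sH : forall i j, sqint (H i j).
Hypothesis weakA : forall i j, is_weak_partial [:: i] (u j) (A i j).
Hypothesis weakH : forall i j (a : 'I_3 -> R -> R), (forall i, bump_fun (a i)) ->
  (\int[@leb3 R]_x (f x * tensor (mderive [:: i; j] a) x)%:E =
   \int[@leb3 R]_x (H i j x * tensor a x)%:E)%E.
Hypothesis div0 : \forall x \ae (@leb3 R), \sum_(j < 3) A j j x = 0.

(** The weak form of d_m (d_i u_j) = d_i (d_m u_j): move both derivatives onto
    the test function, where they commute. *)
Lemma gradient_swap i j m (a : 'I_3 -> R -> R) : (forall i, bump_fun (a i)) ->
  \int[@leb3 R]_x (A i j x * tensor (mderive [:: m] a) x) =
  \int[@leb3 R]_x (A m j x * tensor (mderive [:: i] a) x).
Proof.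
move=> ba; congr fine.
have weak k l : (\int[@leb3 R]_x (u j x * tensor (mderive [:: k; l] a) x)%:E =
    - \int[@leb3 R]_x (A k j x * tensor (mderive [:: l] a) x)%:E)%E.
  have bl i0 : bump_fun (mderive [:: l] a i0) by exact: bump_mderive.
  have [_ /(_ _ (test_function_tensor bl))] := weakA k j.
  rewrite partial_tensor; last by move=> i0; case: (bl i0).
  by rewrite -mderive_cat expr1 EFinN mulN1e.
apply: oppe_inj; rewrite -!weak.
by rewrite (@mderive_perm _ [:: i; m] [:: m; i])// (perm_catC [:: i] [:: m]).
Qed.

(** The weak form of d_i (d_i d_j f) = d_j (d_i d_i f). *)
Lemma hessian_swap i j (a : 'I_3 -> R -> R) : (forall i, bump_fun (a i)) ->
  \int[@leb3 R]_x (H i j x * tensor (mderive [:: i] a) x) =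
  \int[@leb3 R]_x (H i i x * tensor (mderive [:: j] a) x).
Proof.
move=> ba; congr fine.
have bd k i0 : bump_fun (mderive [:: k] a i0) by exact: bump_mderive.
rewrite -(weakH i j (bd i)) -(weakH i i (bd j)) -!mderive_cat.
rewrite (@mderive_perm _ ([:: i; j] ++ [:: i]) ([:: i; i] ++ [:: j]))//.
by rewrite /= perm_cons (perm_catC [:: j] [:: i]).
Qed.

Section Kernel.
Variable a : 'I_3 -> R -> R.
Hypothesis ba : forall i, bump_fun (a i).

Let bd k i : bump_fun (mderive [:: k] a i).
Proof. exact: bump_mderive. Qed.

Let sK k : schur_kernel (@leb3 R) (mass (mderive [:: k] a))
  (diff_kernel (mderive [:: k] a)).
Proof. by apply: schur_diff_kernel => i; exact: bd. Qed.

Lemma kform_gradient_swap i j m B : sqint B ->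
  'K[mderive [:: m] a] (A i j) B = 'K[mderive [:: i] a] (A m j) B.
Proof.
move=> sB; rewrite (diff_kernel_fubini2 (bd m) (sA i j) sB).
rewrite (diff_kernel_fubini2 (bd i) (sA m j) sB).
apply: eq_Rintegral => x _; congr (_ * _).
rewrite -!mderive1_translate//; apply: gradient_swap => k.
exact: bump_translate.
Qed.

Lemma kform_hessian_swap i j B : sqint B ->
  'K[mderive [:: i] a] B (H i j) = 'K[mderive [:: j] a] B (H i i).
Proof.
move=> sB; rewrite (diff_kernel_fubini1 (bd i) sB (sH i j)).
rewrite (diff_kernel_fubini1 (bd j) sB (sH i i)).
apply: eq_Rintegral => z _; congr (_ * _).
have h k l : \int[@leb3 R]_x (H i l x * tensor (reflect3 (mderive [:: k] a) z) x) =
    - \int[@leb3 R]_x (H i l x * tensor (mderive [:: k] (reflect3 a z)) x).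
  rewrite -mulN1r -RintegralZl//; last first.
    apply: integrableM_sqint => //; apply: sqint_tensor => i0.
    by apply: bump_mderive => i1; exact: bump_reflect.
  apply: eq_Rintegral => x _.
  by rewrite tensor_mderive1_reflect// mulrN mulrN mulN1r opprK.
rewrite !h; congr (- _); apply: hessian_swap => k.
exact: bump_reflect.
Qed.

(** The gradient of the correlation vanishes:
    d_m A_ij . H_ij = d_i A_mj . H_ij = d_j A_mj . H_ii = d_m A_jj . H_ii
    where each derivative falls on the kernel, and sum_j A_jj is the
    divergence. *)
Lemma sum_kform_eq0 m : \sum_(i < 3) \sum_(j < 3)
  'K[mderive [:: m] a] (A i j) (H i j) = 0.
Proof.
have E i j : 'K[mderive [:: m] a] (A i j) (H i j) =
    'K[mderive [:: m] a] (A j j) (H i i).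
  rewrite (kform_gradient_swap i j m)// kform_hessian_swap//.
  by rewrite -kform_gradient_swap.
apply: big1 => i _; under eq_bigr => j _ do rewrite E.
pose D x := A 0 0 x + (A 1 1 x + A 2 2 x).
have sD : sqint D by apply: sqintD => //; exact: sqintD.
have -> : \sum_(j < 3) 'K[mderive [:: m] a] (A j j) (H i i) =
    'K[mderive [:: m] a] D (H i i).
  have h X Y : sqint X -> sqint Y ->
      'K[mderive [:: m] a] (fun x => X x + Y x) (H i i) =
      'K[mderive [:: m] a] X (H i i) + 'K[mderive [:: m] a] Y (H i i).
    move=> sX sY; have := kformDl 1 (sK m) sX sY (sH i i); rewrite mul1r => <-.
    by congr (kform _ _ _); apply/funext => x; rewrite mul1r.
  rewrite h//; last exact: sqintD.
  rewrite h// !big_ord_recl big_ord0 addr0.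
  do 2![congr (_ + _)]; by congr ('K[_] (A _ _) _); exact: val_inj.
rewrite (diff_kernel_fubini2 (bd m) sD (sH i i)).
rewrite (@eq_Rintegral _ _ _ _ _ (fun=> 0)); first by rewrite Rintegral_cst// mul0r.
move=> x _; rewrite /Rintegral (ae_eq_integral (cst 0%E))//.
- by rewrite integral0 mulr0.
- apply/measurable_EFinP/measurable_funM; first by case: sD.
  apply: measurable_tensor => i0; apply: measurable_bump.
  by apply: bump_translate => i1; exact: bd.
- move: div0.
  apply: (@filterS _ _ (ae_filter_ringOfSetsType (@leb3 R))) => y hy _ /=.
  have -> : D y = 0; last by rewrite mul0r.
  rewrite -hy /D !big_ord_recl big_ord0 addr0.
  do 2![congr (_ + _)]; by congr (A _ _ _); exact: val_inj.
Qed.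

End Kernel.

(** Summed over i and j, the averages near the origin and those at distance n
    have the same value for every n; the first tend to the integrals, the
    second to 0. *)
Lemma gradient_hessian_orthogonal :
  \sum_(i < 3) \sum_(j < 3) \int[@leb3 R]_x (A i j x * H i j x) = 0.
Proof.
have kernel_split i j n : 'K[mderive [:: 0] (@transport R n)] (A i j) (H i j) =
    'K[@near_mollifier R n] (A i j) (H i j) - 'K[@far_mollifier R n] (A i j) (H i j).
  rewrite /kform -RintegralB//; last first.
  - exact: kform_integrable (schur_diff_kernel (bump_far R n)) (sA i j) (sH i j).
  - exact: kform_integrable (schur_diff_kernel (bump_near R n)) (sA i j) (sH i j).
  by apply: eq_Rintegral => p _; rewrite diff_kernel_transport mulrBr.
have lim_ij i j : 'K[mderive [:: 0] (@transport R n)] (A i j) (H i j) @[n --> \oo] -->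
    \int[@leb3 R]_x (A i j x * H i j x).
  rewrite -[X in _ --> X]subr0; under eq_cvg do rewrite kernel_split.
  by apply: cvgB; [exact: kform_near|exact: kform_far].
have lim_sum : (\sum_(i < 3) \sum_(j < 3)
      'K[mderive [:: 0] (@transport R n)] (A i j) (H i j)) @[n --> \oo] -->
    \sum_(i < 3) \sum_(j < 3) \int[@leb3 R]_x (A i j x * H i j x).
  apply: cvg_big => [|i _]; first exact: add_continuous.
  by apply: cvg_big => [|j _]; first exact: add_continuous.
have lim0 : (\sum_(i < 3) \sum_(j < 3)
    'K[mderive [:: 0] (@transport R n)] (A i j) (H i j)) @[n --> \oo] --> (0 : R).
  under eq_cvg do rewrite (sum_kform_eq0 (bump_transport R _)).
  exact: cvg_cst.
exact: (cvg_unique _ lim_sum lim0).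
Qed.

End Orthogonality.

(** * From weak derivatives to the strain space *)

Section Assembly.
Variable R : realType.
Local Notation sqint := (@sqint _ _ _ (@leb3 R)).

Lemma weak_partialP s (f : R * R * R -> R) : weakly_differentiable s f ->
  is_weak_partial s f (weak_partial s f).
Proof. by move=> [g fg]; exact: (xgetPex (fun=> 0) (ex_intro _ g fg)). Qed.

Lemma L2_sqint (f : R * R * R -> R) : L2 f -> sqint f.
Proof. exact: Lfun2_sqint. Qed.

Lemma integral_sum2 (F : 'I_3 -> 'I_3 -> R * R * R -> R) :
  (forall i j, (@leb3 R).-integrable setT (EFin \o F i j)) ->
  (\int[@leb3 R]_x (\sum_(i < 3) \sum_(j < 3) F i j x)%:E =
   (\sum_(i < 3) \sum_(j < 3) \int[@leb3 R]_x F i j x)%:E)%E.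
Proof.
move=> IF; under eq_integral => x _.
  rewrite -sumEFin; under eq_bigr => i _ do rewrite -sumEFin.
  over.
rewrite integral_sum//; last by move=> i; apply: integrable_sum => // j _; exact: IF.
rewrite -sumEFin; apply: eq_bigr => i _.
rewrite integral_sum//; last by move=> j; exact: IF.
rewrite -sumEFin; apply: eq_bigr => j _.
by rewrite /Rintegral fineK//; exact: (integrable_fin_num _ (IF i j)).
Qed.

Lemma measurable_sum2 (F : 'I_3 -> 'I_3 -> R * R * R -> R) :
  (forall i j, measurable_fun (setT : set (mR3 R)) (F i j)) ->
  measurable_fun (setT : set (mR3 R))
    (fun x => (\sum_(i < 3) \sum_(j < 3) F i j x)%:E).
Proof.
move=> mF; apply/measurable_EFinP.
by apply: measurable_sum => i; apply: measurable_sum => j; exact: mF.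
Qed.

End Assembly.

Theorem proposition2p4 (R : realType) :
  forall f : R * R * R -> R, Hdot 2 f ->
  forall g : R * R * R -> R, L2 g ->
  forall S : R * R * R -> 'M[R]_3, L2_st S ->
    inner S (fun x => g x *: 1%:M) = 0%E /\ inner S (Hess f) = 0%E.
Proof.
move=> f [_ hf] g Lg S [[LS _] [u [hu divu Su]]].
pose A i j := weak_partial [:: i] (fun y => u y 0 j).
pose H i j := weak_partial [:: i; j] f.
have sg := L2_sqint Lg.
have sS i j : sqint (@leb3 R) (fun x => S x i j) by exact/L2_sqint/LS.
have sA i j : sqint (@leb3 R) (A i j).
  by have [_ /(_ [:: i] erefl)[_ /L2_sqint]] := hu j.
have sH i j : sqint (@leb3 R) (H i j).
  by have [_ /L2_sqint] := hf [:: i; j] erefl.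
have weakA i j : is_weak_partial [:: i] (fun y => u y 0 j) (A i j).
  by have [_ /(_ [:: i] erefl)[/weak_partialP]] := hu j.
have weakH i j (a : 'I_3 -> R -> R) : (forall i, bump_fun (a i)) ->
    (\int[@leb3 R]_x (f x * tensor (mderive [:: i; j] a) x)%:E =
     \int[@leb3 R]_x (H i j x * tensor a x)%:E)%E.
  move=> ba; have [/weak_partialP [_ wH] _] := hf [:: i; j] erefl.
  rewrite -partial_tensor; last by move=> k; case: (ba k).
  rewrite wH; last exact: test_function_tensor.
  by rewrite expr2 mulrNN mulr1 mul1e.
have ae_filter : Filter (almost_everywhere (@leb3 R)).
  exact: ae_filter_ringOfSetsType.
have mS i j : measurable_fun (setT : set (mR3 R)) (fun x => S x i j) by case: (sS i j).
have mA i j : measurable_fun (setT : set (mR3 R)) (A i j) by case: (sA i j).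
have mH i j : measurable_fun (setT : set (mR3 R)) (H i j) by case: (sH i j).
have mg : measurable_fun (setT : set (mR3 R)) g by case: sg.
split.
  rewrite /inner (ae_eq_integral (cst 0%E))//; first exact: integral0.
    apply: measurable_sum2 => i j; apply: measurable_funM => //.
    under eq_fun do rewrite !mxE.
    exact: measurable_funM.
  apply: filterS2 divu Su => x dx Sx _ /=; congr EFin.
  (* Off-diagonal entries of g I vanish: what remains is g times the trace. *)
  transitivity (g x * div u x); last by rewrite dx mulr0.
  rewrite /div mulr_sumr; apply: eq_bigr => i _.
  rewrite (bigD1 i)//= big1 ?addr0; last first.
    by move=> j ji; rewrite !mxE eq_sym (negbTE ji) !mulr0.
  rewrite Sx !mxE eqxx mulr1 mulrC; congr (_ * _).
  by field.
have IAH i j k l : (@leb3 R).-integrable setT (EFin \o (fun x => A i j x * H k l x)).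
  exact: integrableM_sqint.
have ortho1 : \sum_(i < 3) \sum_(j < 3) \int[@leb3 R]_x (A i j x * H i j x) = 0.
  exact: (gradient_hessian_orthogonal (f := f) sA sH weakA weakH).
(* The transpose of H satisfies the same weak identities as H, because the
   derivatives of a test function commute. *)
have ortho2 : \sum_(i < 3) \sum_(j < 3) \int[@leb3 R]_x (A i j x * H j i x) = 0.
  have weakHT i j (a : 'I_3 -> R -> R) : (forall i, bump_fun (a i)) ->
      (\int[@leb3 R]_x (f x * tensor (mderive [:: i; j] a) x)%:E =
       \int[@leb3 R]_x (H j i x * tensor a x)%:E)%E.
    move=> ba; rewrite -weakH// (@mderive_perm _ [:: i; j] [:: j; i])//.
    by rewrite (perm_catC [:: i] [:: j]).
  exact: (@gradient_hessian_orthogonal R A (fun i j => H j i) _ f sA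
    (fun i j => sH j i) weakA weakHT divu).
pose F i j x := 2^-1 * (A i j x * H i j x + A j i x * H i j x).
have IF i j : (@leb3 R).-integrable setT (EFin \o F i j).
  have I := integrableD measurableT (IAH i j i j) (IAH j i i j).
  exact: (integrableZl measurableT 2^-1 I).
rewrite /inner (ae_eq_integral
  (fun x : mR3 R => (\sum_(i < 3) \sum_(j < 3) F i j x)%:E))//.
- rewrite integral_sum2//; congr EFin.
  have -> : \sum_(i < 3) \sum_(j < 3) \int[@leb3 R]_x F i j x =
      2^-1 * (\sum_(i < 3) \sum_(j < 3) \int[@leb3 R]_x (A i j x * H i j x) +
              \sum_(i < 3) \sum_(j < 3) \int[@leb3 R]_x (A i j x * H j i x)).
    rewrite [X in _ + X]exchange_big/= -big_split/= mulr_sumr.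
    apply: eq_bigr => i _; rewrite -big_split/= mulr_sumr; apply: eq_bigr => j _.
    have I := integrableD measurableT (IAH i j i j) (IAH j i i j).
    rewrite -RintegralD// -RintegralZl//.
  by rewrite [X in X + _]ortho1 [X in _ + X]ortho2 addr0 mulr0.
- apply: measurable_sum2 => i j; apply: measurable_funM => //.
  by under eq_fun do rewrite mxE; exact: mH.
- by apply: measurable_sum2 => i j; have /measurable_int/measurable_EFinP := IF i j.
- apply: filterS Su => x Sx _ /=; congr EFin.
  apply: eq_bigr => i _; apply: eq_bigr => j _.
  by rewrite Sx !mxE /F /A /H -mulrDl mulrA.
Qed.
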